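(* Let $d,q,n\in\mathbb N^*$, let $X_0$ be an $\mathbb R^d$-valued random vector and let $(Z_k)_{k=1,\dots,n}$ be independent, square integrable, centered $\mathbb R^q$-valued random vectors, independent of $X_0$. For $k=1,\dots,n$ let $\breve Z_k=\varphi_k(Z_k)$ with $\varphi_k:\mathbb R^q\to\mathbb R^q$ Borel and bounded, $\mathbb E\,\breve Z_k=0$ and $\mathbb E[(Z_k^i-\breve Z_k^i)\breve Z_k^j]=0$ for all $i,j\in\{1,\dots,q\}$. Let $(U_k)_{k=1,\dots,n}$ be independent random variables uniformly distributed on $[0,1]$, independent of $(X_0,(Z_k)_{k=1,\dots,n})$. Let $\vartheta_k:\mathbb R^d\to\mathbb M_{d,q}$, $k=0,\dots,n-1$, be locally bounded Borel functions, let $g_0:\mathbb R^d\to\mathbb R^d$ be Borel with finite range $\Gamma_0=g_0(\mathbb R^d)$, and let $\Gamma_1,\dots,\Gamma_n\subset\mathbb R^d$ be grids such that, for every $k=1,\dots,n$ and $x\in\Gamma_{k-1}$, $x+\vartheta_{k-1}(x)\breve Z_k(\Omega)\subset\mathrm{conv}(\Gamma_k)$. Define $\breve X_0=g_0(X_0)$, $\widehat X_0=g_0(X_0)$ and, for $k=0,\dots,n-1$, $$\breve X_{k+1}=\breve X_k+\vartheta_k(\breve X_k)\breve Z_{k+1},\qquad\widetilde X_{k+1}=\widehat X_k+\vartheta_k(\widehat X_k)\breve Z_{k+1},\qquad\widehat X_{k+1}=\mathrm{Proj}^{del}_{\Gamma_{k+1}}(\widetilde X_{k+1},U_{k+1}).$$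 Assume that one of the following holds: (A) the functions $\vartheta_k$, $k=0,\dots,n-1$, are convex in the matrix sense with linear growth and the random vectors $\breve Z_k$, $k=1,\dots,n$, have a radial distribution; (B) $q=d$ and, for each $k=0,\dots,n-1$, one of the following three conditions holds: - $\breve Z_{k+1}$ satisfies the vanishing conditional expectations assumption and $\vartheta_k$ is diagonal with nonnegative convex diagonal entries; - $\breve Z_{k+1}$ satisfies the symmetric conditional laws assumption and $\vartheta_k$ is diagonal with diagonal entries whose absolute values are convex; - $\breve Z_{k+1}$ has a radial distribution and $\vartheta_k$ is convex in the matrix sense. If $\breve X_0\le_{cvx}\widehat X_0$, then $$(\breve X_k)_{k=0,\dots,n}\le_{cvx}(\widehat X_k)_{k=0,\dots,n}.$$
   Context: $\mathbb M_{d,q}$ is the space of real $d\times q$ matrices. For integrable random vectors $X,Y$ with values in the same $\mathbb R^m$, $X\le_{cvx}Y$ means $\mathbb E\,\varphi(X)\le\mathbb E\,\varphi(Y)$ for every convex $\varphi:\mathbb R^m\to\mathbb R$; for processes $(X_k)_{k=0,\dots,n}$ it is understood for the $(\mathbb R^d)^{n+1}$-valued vectors $(X_0,\dots,X_n)$. A function $\vartheta:\mathbb R^d\to\mathbb M_{d,q}$ is convex in the matrix sense if for all $x,y\in\mathbb R^d$ and $\alpha\in[0,1]$ there exists an orthogonal matrix $O\in\mathbb M_{q,q}$ such that $$\vartheta\vartheta^*(\alpha x+(1-\alpha)y)\le\big(\alpha\vartheta(x)+(1-\alpha)\vartheta(y)O\big)\big(\alpha\vartheta(x)+(1-\alpha)\vartheta(y)O\big)^*,$$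 with $\le$ the positive semidefinite order on symmetric matrices and $\vartheta\vartheta^*(x)=\vartheta(x)\vartheta(x)^*$. Linear growth: the norm of $\vartheta(x)$ is at most $C(1+|x|)$ for some constant $C$. For a random vector $Z$ in $\mathbb R^q$ with coordinates $Z_1,\dots,Z_q$ (coordinates of a vector already carrying an index are written as superscripts), let $Z_{-i}$ be the subvector obtained by removing the $i$-th coordinate. $Z$ satisfies the vanishing conditional expectations assumption if $\mathbb E[Z_i\mid Z_{-i}]=0$ a.s. for each $i$; the symmetric conditional laws assumption if, for each $i$, the conditional laws of $Z_i$ and $-Z_i$ given $Z_{-i}$ coincide a.s.; and has a radial distribution if $OZ$ has the same distribution as $Z$ for every orthogonal $O\in\mathbb M_{q,q}$. A grid is a finite subset of $\mathbb R^d$; $\mathrm{conv}$ denotes the convex hull. Dual (Delaunay) projection. Let $\Gamma=\{x_1,\dots,x_N\}$ be a grid containing an affine basis of $\mathbb R^d$ (otherwise replace $\mathbb R^d$ by the affine span of $\Gamma$). Fix a Delaunay triangulation of $\Gamma$, i.e. a triangulation of $\mathrm{conv}(\Gamma)$ into nondegenerate simplices with vertices in $\Gamma$ such that the open ball circumscribed to each simplex contains no point of $\Gamma$, and let $(D_k(\Gamma))_{1\le k\le m}$ be an associated Borel partition of $\mathrm{conv}(\Gamma)$, $D_k(\Gamma)$ being included in the $k$-th (closed) simplex. For $\xi\in D_k(\Gamma)$ let $\lambda^k_i(\xi)$, $i=1,\dots,N$, be the barycentric coordinates of $\xi$ in the $k$-th simplex, with $\lambda_i^k(\xi)=0$ if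 $x_i$ is not a vertex of it. Then, for $\xi\in\mathrm{conv}(\Gamma)$ and $u\in[0,1]$, $$\mathrm{Proj}^{del}_\Gamma(\xi,u)=\sum_{k=1}^m\Big[\sum_{i=1}^N x_i\,\mathbf 1_{\{\sum_{j=1}^{i-1}\lambda^k_j(\xi)\le u<\sum_{j=1}^i\lambda_j^k(\xi)\}}\Big]\mathbf 1_{D_k(\Gamma)}(\xi).$$ *)

(* Defs.v *)
From HB Require Import structures.
From mathcomp Require Import all_boot all_order all_algebra.
From mathcomp Require Import all_classical all_reals all_analysis.

Set Implicit Arguments.
Unset Strict Implicit.
Unset Printing Implicit Defensive.

Import Order.TTheory GRing.Theory Num.Theory.
Import numFieldNormedType.Exports.

Local Open Scope classical_set_scope.
Local Open Scope ring_scope.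

(* R^d is 'cV[R]_d and M_{d,q} is 'M[R]_(d, q), both with their Borel
   sigma-algebra. *)
HB.instance Definition _ (R : realType) (m n : nat) :=
  @isMeasurable.Build (sigma_display (@open 'M[R]_(m, n))) 'M[R]_(m, n)
    <<s open >> (@sigma_algebra0 _ setT _) (@sigma_algebraC _ _)
    (@sigma_algebra_bigcup _ setT _).

Section matrices.
Context {R : realType}.

Definition psdmx m (M : 'M[R]_m) : Prop :=
  M^T = M /\ forall v : 'cV[R]_m, 0 <= (v^T *m M *m v) 0 0.

Definition psd_le m (A B : 'M[R]_m) : Prop := psdmx (B - A).

Definition orthogonal_mx m (O : 'M[R]_m) : Prop := O *m O^T = 1%:M.

Definition mx_convex d q (th : 'cV[R]_d -> 'M[R]_(d, q)) : Prop :=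
  forall (x y : 'cV[R]_d) (a : R), 0 <= a <= 1 ->
  exists2 O : 'M[R]_q, orthogonal_mx O &
    let C := th (a *: x + (1 - a) *: y) in
    let B := a *: th x + (1 - a) *: (th y *m O) in
    psd_le (C *m C^T) (B *m B^T).

Definition linear_growth d q (th : 'cV[R]_d -> 'M[R]_(d, q)) : Prop :=
  exists C : R, forall x, `|th x| <= C * (1 + `|x|).

(* The next two notions are used when q = d; the dimensions are kept distinct
   so that this can be an equation rather than a conversion. *)
Definition diag_nonneg_convex d q (th : 'cV[R]_d -> 'M[R]_(d, q)) : Prop :=
  (forall x, is_diag_mx (th x)) /\
  forall (i : 'I_d) (j : 'I_q), i = j :> nat ->
    (forall x, 0 <= th x i j) /\
    convex_function [set: convex_lmodType 'cV[R]_d] (fun x => th x i j).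

Definition diag_abs_convex d q (th : 'cV[R]_d -> 'M[R]_(d, q)) : Prop :=
  (forall x, is_diag_mx (th x)) /\
  forall (i : 'I_d) (j : 'I_q), i = j :> nat ->
    convex_function [set: convex_lmodType 'cV[R]_d] (fun x => `|th x i j|).

End matrices.

Section probability_notions.
Context {dT : measure_display} {T : measurableType dT} {R : realType}.
Variable P : probability T R.

Definition sigma_of {dE : measure_display} {E : measurableType dE}
    (X : T -> E) : set (set T) :=
  preimage_set_system setT X measurable.

Definition indep_family (I : finType) (F : I -> set (set T)) : Prop :=
  forall (J : {set I}) (A : I -> set T), (forall i, i \in J -> F i (A i)) ->
  P (\bigcap_(i in [set` J]) A i) = (\prod_(i in J) P (A i))%E.

Definition indep (F G : set (set T)) : Prop :=
  forall A B, F A -> G B -> P (A `&` B) = (P A * P B)%E.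

Definition integrable_vec m p (X : T -> 'M[R]_(m, p)) : Prop :=
  measurable_fun setT X /\
  forall i j, P.-integrable setT (fun w => (X w i j)%:E).

(* For integrable X and convex f, the negative part of f \o X is integrable, so
   that the expectations below are meaningful in ]-oo, +oo]. *)
Definition cvx_le m p (X Y : T -> 'M[R]_(m, p)) : Prop :=
  [/\ integrable_vec X, integrable_vec Y &
   forall f : 'M[R]_(m, p) -> R,
     convex_function [set: convex_lmodType 'M[R]_(m, p)] f ->
     ('E_P[f \o X] <= 'E_P[f \o Y])%E].

Definition is_cond_exp (F : set (set T)) (X Y : T -> R) : Prop :=
  [/\ P.-integrable setT (EFin \o X), P.-integrable setT (EFin \o Y),
      forall B, measurable B -> F (Y @^-1` B) &
      forall A, F A ->
        (\int[P]_(w in A) (Y w)%:E = \int[P]_(w in A) (X w)%:E)%E].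

(* K is a regular conditional distribution of X given V. *)
Definition is_cond_law {dE : measure_display} {E : measurableType dE}
    (V : T -> E) (X : T -> R) (K : R.-pker E ~> R) : Prop :=
  forall (A : set E) (B : set R), measurable A -> measurable B ->
  P (V @^-1` A `&` X @^-1` B) = (\int[P]_(w in V @^-1` A) K (V w) B)%E.

Variable q : nat.
Implicit Types Z : T -> 'cV[R]_q.

Definition coord Z (i : 'I_q) (w : T) : R := Z w i 0.

Definition others Z (i : 'I_q) (w : T) : 'cV[R]_q.-1 := row' i (Z w).

Definition vanishing_cond_exp Z : Prop :=
  forall i, is_cond_exp (sigma_of (others Z i)) (coord Z i) (cst 0).

Definition symmetric_cond_laws Z : Prop :=
  forall i, exists K K' : R.-pker 'cV[R]_q.-1 ~> R,
    [/\ is_cond_law (others Z i) (coord Z i) K,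
        is_cond_law (others Z i) (fun w => - coord Z i w) K' &
        {ae P, forall w, forall B, measurable B ->
           K (others Z i w) B = K' (others Z i w) B}].

Definition radial Z : Prop :=
  forall O : 'M[R]_q, orthogonal_mx O ->
  forall B : set 'cV[R]_q, measurable B ->
    P ((fun w => O *m Z w) @^-1` B) = P (Z @^-1` B).

Definition square_integrable Z : Prop :=
  forall i, P.-integrable setT (fun w => (coord Z i w ^+ 2)%:E).

Definition centered Z : Prop :=
  forall i, ('E_P[coord Z i] = 0)%E.

End probability_notions.

Section hulls.
Context {R : realType} {E : lmodType R}.

Definition aff_hull (A : set E) : set E :=
  [set y | exists N (x : 'I_N -> E) (l : 'I_N -> R),
    [/\ forall i, A (x i), \sum_i l i = 1 & y = \sum_i l i *: x i]].

Definition conv_hull (A : set E) : set E :=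
  [set y | exists N (x : 'I_N -> E) (l : 'I_N -> R),
    [/\ forall i, A (x i), forall i, 0 <= l i, \sum_i l i = 1 &
        y = \sum_i l i *: x i]].

End hulls.

Section delaunay.
Context {R : realType} {d : nat}.

(* The norm of the library on matrices is the sup norm; circumscribed balls are
   Euclidean. *)
Definition edist (x y : 'cV[R]_d) : R :=
  Num.sqrt (\sum_i (x i 0 - y i 0) ^+ 2).

(* An enumerated grid, simplices given by the indices of their vertices, and
   the cells D_k partitioning the convex hull of the grid. *)
Record dual_scheme := DualScheme {
  ds_size : nat;
  ds_point : 'I_ds_size -> 'cV[R]_d;
  ds_num : nat;
  ds_simplex : 'I_ds_num -> {set 'I_ds_size};
  ds_cell : 'I_ds_num -> set 'cV[R]_d }.

Implicit Types (t : dual_scheme) (G : set 'cV[R]_d).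

Definition vertices t (k : 'I_(ds_num t)) : set 'cV[R]_d :=
  [set ds_point i | i in [set` ds_simplex k]].

Definition enumerates t G : Prop :=
  injective (@ds_point t) /\ range (@ds_point t) = G.

Definition aff_indep t (S : {set 'I_(ds_size t)}) : Prop :=
  forall l : 'I_(ds_size t) -> R,
    \sum_(i in S) l i = 0 -> \sum_(i in S) l i *: ds_point i = 0 ->
    forall i, i \in S -> l i = 0.

(* Nondegeneracy is relative to the affine span of the grid, which is R^d when
   the grid contains an affine basis. *)
Definition is_triangulation t G : Prop :=
  [/\ injective (@ds_simplex t),
      forall k : 'I_(ds_num t), aff_indep (ds_simplex k),
      forall k : 'I_(ds_num t), aff_hull (vertices k) = aff_hull G,
      \bigcup_(k in [set: 'I_(ds_num t)]) conv_hull (vertices k)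
        = conv_hull G &
      forall k l : 'I_(ds_num t),
        conv_hull (vertices k) `&` conv_hull (vertices l)
          = conv_hull (vertices k `&` vertices l)].

(* The centre c is taken in the affine span of the grid, where it is unique. *)
Definition empty_circumballs t G : Prop :=
  forall k : 'I_(ds_num t), exists (c : 'cV[R]_d) (r : R),
    [/\ aff_hull G c,
        forall x, vertices k x -> edist x c = r &
        G `&` [set x | edist x c < r] = set0].

Definition is_cell_partition t G : Prop :=
  [/\ forall k : 'I_(ds_num t), measurable (ds_cell k),
      trivIset setT (@ds_cell t),
      \bigcup_(k in [set: 'I_(ds_num t)]) ds_cell k = conv_hull G &
      forall k : 'I_(ds_num t), ds_cell k `<=` conv_hull (vertices k)].

Definition delaunay t G : Prop :=
  [/\ enumerates t G, is_triangulation t G, empty_circumballs t G &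
      is_cell_partition t G].

(* Unique by affine independence, when xi lies in the affine span of the
   simplex; the default value 0 is irrelevant. *)
Definition bary t (k : 'I_(ds_num t)) (xi : 'cV[R]_d) :
    {ffun 'I_(ds_size t) -> R} :=
  xget 0 [set l : {ffun 'I_(ds_size t) -> R} |
    [/\ forall i, i \notin ds_simplex k -> l i = 0, \sum_i l i = 1 &
        \sum_i l i *: ds_point i = xi]].

Definition proj_del t (xi : 'cV[R]_d) (u : R) : 'cV[R]_d :=
  \sum_(k < ds_num t) \1_(ds_cell k) xi *:
    (\sum_(i < ds_size t | \sum_(j < ds_size t | (j < i)%N) bary k xi j <= u
                             < \sum_(j < ds_size t | (j <= i)%N) bary k xi j)
       ds_point i).

End delaunay.

Arguments dual_scheme : clear implicits.

Section schemes.
Context {R : realType} {T : Type} {d q : nat}.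
Variables (x0 : T -> 'cV[R]_d) (th : nat -> 'cV[R]_d -> 'M[R]_(d, q)).
Variable Z : nat -> T -> 'cV[R]_q.

Fixpoint euler (k : nat) (w : T) : 'cV[R]_d :=
  if k is k'.+1 then
    euler k' w + th k' (euler k' w) *m Z k'.+1 w
  else x0 w.

Variables (t : nat -> dual_scheme R d) (U : nat -> T -> R).

Fixpoint quant_euler (k : nat) (w : T) : 'cV[R]_d :=
  if k is k'.+1 then
    proj_del (t k'.+1)
      (quant_euler k' w + th k' (quant_euler k' w) *m Z k'.+1 w) (U k'.+1 w)
  else x0 w.

End schemes.

(* (X_0, ..., X_n) as an element of (R^d)^(n+1), X_k being the k-th column. *)
Definition path_vec {R : realType} {T : Type} {d : nat} (n : nat)
    (X : nat -> T -> 'cV[R]_d) (w : T) : 'M[R]_(d, n.+1) :=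
  \matrix_(i < d, k < n.+1) X k w i 0.

(* Main.v *)
Require Import Defs.
From HB Require Import structures.
From mathcomp Require Import all_boot all_order all_algebra.
From mathcomp Require Import all_classical all_reals all_analysis.
From mathcomp Require Import measurable_realfun ring lra.

Set Implicit Arguments.
Unset Strict Implicit.
Unset Printing Implicit Defensive.

Import Order.TTheory GRing.Theory Num.Theory.
Import numFieldNormedType.Exports.

Local Open Scope classical_set_scope.
Local Open Scope ring_scope.

(** Both schemes start from the same point, and a step of each consists of an Euler
    step followed, for the quantized scheme only, by the dual projection.

    The projection of a point [xi] selects a vertex of the simplex of [xi] with
    probability its barycentric coordinate, so it has mean [xi] given everything
    known before the uniform variable is drawn; by Jensen's inequality it can only
    increase the expectation of a convex function of the path
    ([le_expect_proj_del], [le_expect_proj_step]).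

    An Euler step, on the other hand, preserves convexity: if [f] is a convex
    function of the path up to time [k + 1], then the expectation of [f] given the
    path up to time [k] is a convex function of that path ([euler_value_convex]).
    This rests on a comparison of noises ([convex_transport]): the coefficient at
    a barycentre produces a smaller noise, for the convex order, than the
    barycentre of coefficients having the same laws as those at the two points.

    For a radial noise [Z], the expectation of [f (A *m Z)] is a convex function of
    [A] invariant under right multiplication by orthogonal matrices. Such a
    function is monotone in [A *m A^T] ([le_psd_le]): the difference of two Gram
    matrices is removed by finitely many rank one deflations, and each of them
    averages the identity and a Householder reflection. For a diagonal
    coefficient the entries are changed one at a time; their effect is monotone,
    by Jensen's inequality given the other coordinates when the conditional
    expectation vanishes ([vanishing_step]), and by averaging two opposite signs
    when the conditional laws are symmetric ([symmetric_step]).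

    The comparison then follows by induction on time, for all convex functions
    simultaneously. The Euler step replaces [f] by the same convex function for both
    schemes, because the noise is independent of the past ([expect_euler_step]),
    and the projection of the quantized scheme increases the expectation further.
    Everything is bounded, since the coefficients are locally bounded and the
    truncated noises are bounded, and convex functions of finitely many variables
    are continuous, hence measurable and bounded on bounded sets. *)

(** * Convex functions on matrices *)

Section convex_functions.
Context {R : realType} {E : lmodType R}.
Implicit Types (f : E -> R).

(** Unfolded form of [convex_function], with a real weight instead of a point of
    the interval type. *)
Definition is_convex f := forall (a : R) (x y : E), 0 <= a <= 1 ->
  f (a *: x + (1 - a) *: y) <= a * f x + (1 - a) * f y.

Lemma convex_functionP f :
  convex_function [set: convex_lmodType E] f <-> is_convex f.
Proof.
split=> [cf a x y /andP[a0 a1]|cf t x y _ _].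
  pose t : {i01 R} := Itv01 a0 a1.
  by have := cf t x y (mem_set I) (mem_set I).
by apply: cf; rewrite ge0 le1.
Qed.

(** The induction absorbs the points one by one into a weighted base point, which
    avoids renormalising the weights. *)
Lemma convex_jensen f (I : finType) (w : I -> R) (x : I -> E) : is_convex f ->
  (forall i, 0 <= w i) -> \sum_i w i = 1 ->
  f (\sum_i w i *: x i) <= \sum_i w i * f (x i).
Proof.
move=> cf w0.
suff H (s : seq I) : forall (c : R) y, 0 <= c -> c + \sum_(i <- s) w i = 1 ->
    f (c *: y + \sum_(i <- s) w i *: x i)
    <= c * f y + \sum_(i <- s) w i * f (x i).
  move=> w1; have := H (index_enum I) 0 0 (lexx _).
  by rewrite scale0r !add0r mul0r add0r; apply.
elim: s => [|i s IH] c y c0; first by rewrite !big_nil !addr0 => ->; rewrite !scale1r mul1r.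
rewrite !big_cons => sw.
have [cw|cw] := eqVneq (c + w i) 0.
  have ci : c = 0 /\ w i = 0 by have := w0 i; split; lra.
  have [-> ->] := ci; rewrite !scale0r !mul0r !add0r.
  have := IH 0 y (lexx _); rewrite scale0r mul0r !add0r; apply.
  by rewrite -sw; have [-> ->] := ci; rewrite !add0r.
have cwp : 0 < c + w i by rewrite lt_def cw addr_ge0.
pose a := c / (c + w i).
have a01 : 0 <= a <= 1.
  by rewrite divr_ge0 ?(ltW cwp)//= ler_pdivrMr// mul1r lerDl.
pose y' := a *: y + (1 - a) *: x i.
have e1 : (c + w i) * a = c by rewrite /a mulrC divfK.
have e2 : (c + w i) * (1 - a) = w i by rewrite mulrBr e1 mulr1; ring.
clearbody a.
have -> : c *: y + (w i *: x i + \sum_(j <- s) w j *: x j)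
    = (c + w i) *: y' + \sum_(j <- s) w j *: x j.
  by rewrite /y' scalerDr !scalerA e1 e2 addrA.
apply: le_trans (IH _ _ (ltW cwp) _) _; first by rewrite -addrA.
rewrite addrA lerD2r -[leRHS](_ : (c + w i) * (a * f y + (1 - a) * f (x i)) = _).
  by rewrite ler_wpM2l ?(ltW cwp)//; exact: cf.
by rewrite mulrDr !mulrA e1 e2.
Qed.

Lemma is_convex_max f (x : E) (c t : R) : is_convex f -> `|t| <= c ->
  f (t *: x) <= Num.max (f (c *: x)) (f (- c *: x)).
Proof.
move=> cf; rewrite ler_norml => /andP[ct tc].
have c0 : 0 <= c by lra.
have [cz|cn0] := eqVneq c 0.
  have -> : t = 0 by move: ct tc; rewrite cz; lra.
  by rewrite cz oppr0 maxxx.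
have cp : 0 < c by rewrite lt_def cn0.
pose a := (t + c) / (2 * c).
have a01 : 0 <= a <= 1.
  by rewrite divr_ge0//= ?ler_pdivrMr//; lra.
have -> : t *: x = a *: (c *: x) + (1 - a) *: (- c *: x).
  rewrite !scalerA -scalerDl; congr (_ *: _); rewrite /a; field; exact: cn0.
apply: le_trans (cf _ _ _ a01) _.
set m := Num.max _ _.
have h1 : f (c *: x) <= m by rewrite le_max lexx.
have h2 : f (- c *: x) <= m by rewrite le_max lexx orbT.
have -> : m = a * m + (1 - a) * m by ring.
by case/andP: a01 => a0 a1; rewrite lerD// ler_wpM2l// subr_ge0.
Qed.

Lemma is_convex_line f (u v : E) : is_convex f ->
  forall a s t, 0 <= a <= 1 ->
  f (u + (a * s + (1 - a) * t) *: v) <=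
    a * f (u + s *: v) + (1 - a) * f (u + t *: v).
Proof.
move=> cf a s t a01; rewrite -[X in f X](_ : a *: (u + s *: v) + (1 - a) *: (u + t *: v) = _).
  exact: cf.
by rewrite !scalerDr !scalerA addrACA -scalerDl subrKC scale1r -scalerDl.
Qed.

End convex_functions.

Lemma is_convex_affine {R : realType} {E F : lmodType R} (f : F -> R) (L : E -> F) :
  is_convex f ->
  (forall (a : R) x y, L (a *: x + (1 - a) *: y) = a *: L x + (1 - a) *: L y) ->
  is_convex (f \o L).
Proof. by move=> cf hL a x y a01 /=; rewrite hL; exact: cf. Qed.

Section convex_matrix.
Context {R : realType} {m p : nat}.
Implicit Types (f : 'M[R]_(m, p) -> R) (x : 'M[R]_(m, p)).

Lemma mx_norm_entry x i j : `|x i j| <= `|x|.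
Proof.
rewrite -[leRHS]/(mx_norm x) mx_normrE.
exact: (le_bigmax _ (fun ij : 'I_m * 'I_p => `|x ij.1 ij.2|) (i, j)).
Qed.

Lemma mx_norm_le x c : 0 <= c -> (forall i j, `|x i j| <= c) -> `|x| <= c.
Proof.
move=> c0 xc; rewrite -[leLHS]/(mx_norm x) mx_normrE.
by apply/bigmax_leP; split.
Qed.

(** Above: [x] is the mean of its multiples on the coordinate axes, where a convex
    function is bounded by its values at two opposite points. Below: [0] is the
    midpoint of [x] and [- x]. *)
Lemma convex_locally_bounded f : is_convex f ->
  forall r, exists K, forall x, `|x| <= r -> `|f x| <= K.
Proof.
move=> cf r.
pose N : R := #|{: 'I_m * 'I_p}|%:R.
suff [K HK] : exists K, forall x, `|x| <= r -> f x <= K.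
  exists (`|K| + 2 * `|f 0|) => x xr; rewrite ler_norml.
  have h1 := HK _ xr.
  have h2 : f (- x) <= K by apply: HK; rewrite normrN.
  have := cf 2^-1 x (- x).
  rewrite (_ : 1 - 2^-1 = 2^-1 :> R); last by field.
  rewrite scalerN subrr => /(_ ltac:(lra)) h3.
  have h4 := ler_norm K; have h5 := ler_norm (f 0).
  have h6 := ler_norm (- f 0); rewrite normrN in h6.
  apply/andP; split; lra.
case: (posnP #|{: 'I_m * 'I_p}|) => [e0|npos].
  exists (f 0) => x _; rewrite (_ : x = 0)//; apply/matrixP => i j.
  by move: (card0_eq e0 (i, j)); rewrite inE.
have Np : 0 < N by rewrite ltr0n.
pose e (ij : 'I_m * 'I_p) : 'M[R]_(m, p) := delta_mx ij.1 ij.2.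
pose g ij := Num.max (f ((N * `|r|) *: e ij)) (f (- (N * `|r|) *: e ij)).
exists (\sum_ij N^-1 * g ij) => x xr.
have -> : x = \sum_ij N^-1 *: ((N * x ij.1 ij.2) *: e ij).
  under eq_bigr do rewrite scalerA mulKf ?gt_eqF//.
  by rewrite {1}[x]matrix_sum_delta pair_bigA.
apply: le_trans (convex_jensen _ cf _ _) _.
- by move=> _; rewrite invr_ge0 ltW.
- by rewrite sumr_const -mulr_natl mulfV ?gt_eqF.
apply: ler_sum => ij _; rewrite ler_wpM2l ?invr_ge0 ?(ltW Np)//.
apply: is_convex_max => //; rewrite normrM gtr0_norm// ler_pM2l//.
apply: le_trans (mx_norm_entry _ _ _) _; apply: le_trans xr _; exact: ler_norm.
Qed.

(** A bound on the unit ball around a point forces a modulus of continuity there,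
    because a small step is a small fraction of a unit step. *)
Lemma convex_continuous f : is_convex f -> continuous f.
Proof.
move=> cf x.
have cg : is_convex (fun y => f (x + y)).
  apply: (is_convex_affine cf) => a y z.
  by rewrite !scalerDr addrACA -scalerDl subrKC scale1r.
have [K HK] := convex_locally_bounded cg 1.
have K0 : 0 <= K by apply: le_trans (HK 0 _); rewrite ?normr0.
apply/(@cvgrPdist_le _ _ _ _ (nbhs_filter x)) => eps eps0.
pose t := Num.min 1 (eps / (2 * K + 1)).
have t0 : 0 < t by rewrite lt_min ltr01 divr_gt0//; lra.
have t1 : t <= 1 by rewrite ge_min lexx.
have tK : 2 * K * t <= eps.
  apply: (@le_trans _ _ ((2 * K + 1) * t)); first by rewrite ler_wpM2r ?ltW//; lra.
  by rewrite mulrC -ler_pdivlMr ?ge_min ?lexx ?orbT//; lra.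
have step y : `|y| <= t -> f (x + y) - f x <= 2 * K * t.
  move=> yt; have := cf t (x + t^-1 *: y) x.
  rewrite scalerDr scalerA mulfV ?gt_eqF// scale1r addrAC -scalerDl subrKC scale1r.
  rewrite ltW//= t1 => /(_ isT) h.
  have h1 : f (x + t^-1 *: y) <= K.
    apply: le_trans (ler_norm _) (HK _ _).
    by rewrite normrZ gtr0_norm ?invr_gt0// mulrC ler_pdivrMr// mul1r.
  have h2 : - f x <= K.
    apply: le_trans (ler_norm _) _; rewrite normrN.
    by have := HK 0; rewrite normr0 addr0; apply.
  have h3 : t * f (x + t^-1 *: y) <= t * K by rewrite ler_pM2l.
  have h4 : t * (- f x) <= t * K by rewrite ler_pM2l.
  lra.
apply/nbhs_ballP; exists t => // y; rewrite mx_norm_ball /ball_ /= => xyt.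
have yt : `|y - x| <= t by rewrite distrC ltW.
have h1 : f y - f x <= 2 * K * t by rewrite -{1}(subrKC x y); exact: step.
have h2 : f (x - (y - x)) - f x <= 2 * K * t by apply: step; rewrite normrN.
have h3 : f x <= 2^-1 * f y + 2^-1 * f (x - (y - x)).
  have := cf 2^-1 y (x - (y - x)).
  rewrite (_ : 1 - 2^-1 = 2^-1 :> R); last by field.
  rewrite -scalerDr opprB addrCA subrKC.
  by rewrite (_ : x + x = 2 *: x) ?scalerA ?mulVf ?scale1r; [apply; lra | | rewrite scaler_nat mulr2n].
by rewrite ler_norml; apply/andP; split; lra.
Qed.

End convex_matrix.

(** * Matrices with equal Gram matrices *)

Section gram.
Context {R : realType}.

(** The rank one perturbation of the identity along [w]: it is the Householder
    reflection for [k = 2 / |w|^2], and a contraction along [w] for smaller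
    positive [k]. *)
Definition rank1 q (k : R) (w : 'cV[R]_q) : 'M[R]_q := 1%:M - k *: (w *m w^T).

Lemma tr_rank1 q k (w : 'cV[R]_q) : (rank1 k w)^T = rank1 k w.
Proof. by rewrite /rank1 linearB /= linearZ /= trmx_mul trmxK trmx1. Qed.

Lemma rank1_sqr q k (w : 'cV[R]_q) (n := (w^T *m w) 0 0) :
  rank1 k w *m rank1 k w = rank1 (2 * k - k ^+ 2 * n) w.
Proof.
have W : w *m w^T *m (w *m w^T) = n *: (w *m w^T).
  rewrite mulmxA -(mulmxA w) (mx11_scalar (w^T *m w)) -/n.
  by rewrite mul_mx_scalar -scalemxAl.
rewrite /rank1 mulmxBl mul1mx mulmxBr mulmx1 -scalemxAl -scalemxAr W.
clearbody n; move: (w *m w^T) => Q.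
by apply/matrixP => i j; rewrite !mxE; ring.
Qed.

Lemma sqnorm_eq0 q (w : 'cV[R]_q) : ((w^T *m w) 0 0 == 0) = (w == 0).
Proof.
apply/eqP/eqP => [|->]; last by rewrite mulmx0 mxE.
rewrite mxE => /eqP; rewrite psumr_eq0 => [|i _]; last first.
  by rewrite mxE -expr2 sqr_ge0.
move=> /allP h; apply/matrixP => i j; rewrite ord1 [RHS]mxE.
have := h i (mem_index_enum i); rewrite mxE -expr2 sqrf_eq0.
by move/eqP.
Qed.

Lemma sqnorm_ge0 q (w : 'cV[R]_q) : 0 <= (w^T *m w) 0 0.
Proof. by rewrite mxE sumr_ge0// => i _; rewrite mxE -expr2 sqr_ge0. Qed.

Lemma orthogonal_rank1 q (w : 'cV[R]_q) :
  orthogonal_mx (rank1 (2 / (w^T *m w) 0 0) w).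
Proof.
rewrite /orthogonal_mx tr_rank1 rank1_sqr.
have [->|w0] := eqVneq w 0.
  by rewrite /rank1 mul0mx scaler0 subr0.
rewrite (_ : _ - _ = 0) /rank1 ?scale0r ?subr0//.
field; by rewrite sqnorm_eq0.
Qed.

Lemma orthogonal_mul q (O Q : 'M[R]_q) :
  orthogonal_mx O -> orthogonal_mx Q -> orthogonal_mx (O *m Q).
Proof.
rewrite /orthogonal_mx => hO hQ.
by rewrite trmx_mul mulmxA -(mulmxA O) hQ mulmx1 hO.
Qed.

Lemma orthogonal_gram m q (A : 'M[R]_(m, q)) (O : 'M[R]_q) :
  orthogonal_mx O -> A *m O *m (A *m O)^T = A *m A^T.
Proof. by move=> hO; rewrite trmx_mul mulmxA -(mulmxA A) hO mulmx1. Qed.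

(** The rows are aligned one after the other; the reflection that sends the
    next row of [A] to the corresponding row of [B] fixes the rows already
    aligned, since these have the same inner product with both. *)
Lemma gram_eq_orthogonal m q (A B : 'M[R]_(m, q)) : A *m A^T = B *m B^T ->
  exists2 O : 'M[R]_q, orthogonal_mx O & B = A *m O.
Proof.
move=> AB.
suff H k : (k <= m)%N -> exists2 O : 'M[R]_q, orthogonal_mx O &
    forall i : 'I_m, (i < k)%N -> row i (A *m O) = row i B.
  have [ O hO AO] := H m (leqnn m); exists O => //.
  by apply/row_matrixP => i; rewrite AO.
elim: k => [_|k IH km]; first by exists 1%:M; rewrite ?/orthogonal_mx ?trmx1 ?mul1mx.
have [ O hO AO] := IH (ltnW km).
pose C := A *m O.
have CB : C *m C^T = B *m B^T by rewrite orthogonal_gram.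
pose K := Ordinal km.
pose w : 'cV[R]_q := (row K C - row K B)^T.
have dots i j : (row i C *m (row j C)^T) = (row i B *m (row j B)^T).
  have e (M : 'M[R]_(m, q)) : row i M *m (row j M)^T = row i (M *m M^T *m (delta_mx j (0 : 'I_1))).
    by rewrite rowE [row j M]rowE trmx_mul trmx_delta !rowE !mulmxA.
  by rewrite !e CB.
exists (O *m rank1 (2 / (w^T *m w) 0 0) w).
  exact/orthogonal_mul/orthogonal_rank1.
move=> i; rewrite ltnS leq_eqVlt mulmxA -/C => ik.
rewrite row_mul /rank1 mulmxBr mulmx1 -scalemxAr mulmxA.
have wE : w = (row K C)^T - (row K B)^T by rewrite /w linearB.
case/orP: ik => [/eqP iK|ik].
  have {iK} -> : i = K by apply: val_inj.
  have [w0|w0] := eqVneq w 0.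
    have -> : row K C *m w *m w^T = 0 by rewrite w0 mulmx0 mul0mx.
    rewrite scaler0 subr0; apply: trmx_inj; apply/eqP.
    by rewrite -subr_eq0 -wE w0.
  have nE : (w^T *m w) 0 0 = 2 * (row K C *m w) 0 0.
    have := dots K K; rewrite wE [(_ - _)^T]linearB /= !trmxK.
    move: (row K C) (row K B) => c b /matrixP/(_ 0 0) cb.
    have bc : (b *m c^T) 0 0 = (c *m b^T) 0 0.
      by rewrite -[b *m c^T]trmxK trmx_mul trmxK [LHS]mxE.
    rewrite mulmxBl !mulmxBr; move: cb bc.
    move: (c *m c^T) (b *m b^T) (b *m c^T) (c *m b^T) => x y z t.
    by rewrite !mxE => -> ->; ring.
  have w1 : w^T = row K C - row K B by rewrite trmxK.
  have cw0 : (row K C *m w) 0 0 != 0.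
    by apply: contra_neq w0 => e; apply/eqP; rewrite -sqnorm_eq0 nE e mulr0.
  rewrite [row K C *m w]mx11_scalar mul_scalar_mx scalerA nE.
  rewrite (_ : 2 / _ * _ = 1); last by field.
  by rewrite scale1r w1 opprB addrC subrK.
have -> : row i C *m w = 0.
  by rewrite wE mulmxBr dots (AO _ ik) subrr.
by rewrite mul0mx scaler0 subr0 AO.
Qed.

End gram.

(** * Comparison of Gram matrices and invariant convex functions *)

Section psd_comparison.
Context {R : realType}.

Definition qform m (M : 'M[R]_m) (x y : 'cV[R]_m) : R := (x^T *m M *m y) 0 0.

Lemma qformDl m (M : 'M[R]_m) x y z : qform M (x + y) z = qform M x z + qform M y z.
Proof. by rewrite /qform [(x + y)^T]linearD /= !mulmxDl mxE. Qed.

Lemma qformDr m (M : 'M[R]_m) x y z : qform M x (y + z) = qform M x y + qform M x z.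
Proof. by rewrite /qform mulmxDr mxE. Qed.

Lemma qformZl m (M : 'M[R]_m) a x y : qform M (a *: x) y = a * qform M x y.
Proof. by rewrite /qform [(a *: x)^T]linearZ /= -!scalemxAl mxE. Qed.

Lemma qformZr m (M : 'M[R]_m) a x y : qform M x (a *: y) = a * qform M x y.
Proof. by rewrite /qform -!scalemxAr mxE. Qed.

Lemma qformC m (M : 'M[R]_m) x y : M^T = M -> qform M x y = qform M y x.
Proof.
move=> MT; rewrite /qform -[in RHS]MT -[x in RHS]trmxK -!trmx_mul mulmxA.
by rewrite [RHS]mxE.
Qed.

Lemma psd_cauchy_schwarz m (M : 'M[R]_m) x y : psdmx M ->
  qform M x y ^+ 2 <= qform M x x * qform M y y.
Proof.
case=> MT M0; have q0 v : 0 <= qform M v v by exact: M0.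
have h t : 0 <= qform M x x + 2 * t * qform M x y + t ^+ 2 * qform M y y.
  have := q0 (x + t *: y); rewrite qformDl !qformDr !qformZl !qformZr.
  by rewrite (qformC y x MT); congr (_ <= _); ring.
move: (q0 x) (q0 y) h; move: (qform M x x) (qform M x y) (qform M y y) => a b c a0 c0 h.
have [cz|cn] := eqVneq c 0.
  rewrite cz mulr0 in h *.
  have [->|bn] := eqVneq b 0; first by rewrite expr0n.
  have := h (- (a + 1) / (2 * b)).
  rewrite (_ : 2 * (- (a + 1) / (2 * b)) * b = - (a + 1)); first lra.
  by field.
have cp : 0 < c by rewrite lt_def cn.
have := h (- b / c).
rewrite (_ : a + _ + _ = (a * c - b ^+ 2) / c); last by field.
by rewrite pmulr_lge0 ?invr_gt0// subr_ge0.
Qed.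

Lemma psd_kernel m (M : 'M[R]_m) x : psdmx M -> qform M x x = 0 -> M *m x = 0.
Proof.
move=> pM x0; have [MT _] := pM; apply/eqP; rewrite -sqnorm_eq0.
have : qform M (M *m x) x = 0.
  have := psd_cauchy_schwarz (M *m x) x pM; rewrite x0 mulr0 => h.
  by apply/eqP; rewrite -sqrf_eq0 eq_le h sqr_ge0.
by rewrite /qform -mulmxA => ->.
Qed.

Lemma psd_gram d q (A : 'M[R]_(d, q)) : psdmx (A *m A^T).
Proof.
split=> [|v]; first by rewrite trmx_mul trmxK.
rewrite (_ : _ *m _ = (A^T *m v)^T *m (A^T *m v)) ?sqnorm_ge0//.
by rewrite trmx_mul trmxK !mulmxA.
Qed.

(** The Cauchy-Schwarz inequality keeps the difference positive semidefinite, and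
    the rank drops because [u] joins the kernel. *)
Lemma psd_deflate m (M : 'M[R]_m) : psdmx M -> M != 0 ->
  exists2 u : 'cV[R]_m, 0 < qform M u u &
    let M' := M - (qform M u u)^-1 *: (M *m u *m (M *m u)^T) in
    psdmx M' /\ (\rank M' < \rank M)%N.
Proof.
move=> pM Mn0; have [MT M0] := pM.
have [u qu] : exists u, qform M u u != 0.
  apply: contrapT => /forallNP q0; move/eqP: Mn0; apply.
  apply/matrixP => i j; rewrite [RHS]mxE.
  have /(psd_kernel pM) : qform M (delta_mx j 0) (delta_mx j (0 : 'I_1)) = 0.
    by have := q0 (delta_mx j 0) => /negP; rewrite negbK => /eqP.
  by rewrite -colE => /matrixP/(_ i 0); rewrite !mxE.
have qp : 0 < qform M u u by rewrite lt_def qu; exact: M0.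
exists u => // M'.
have uM : (M *m u)^T = u^T *m M by rewrite trmx_mul MT.
have MuK : M' *m u = 0.
  rewrite /M' mulmxBl uM -scalemxAl -(mulmxA (M *m u)) (mx11_scalar (u^T *m M *m u)).
  by rewrite mul_mx_scalar scalerA -/(qform M u u) mulVf// scale1r subrr.
split.
  split=> [|v].
    by rewrite linearB linearZ /= trmx_mul trmxK MT.
  have key : (v^T *m (M *m u *m (M *m u)^T) *m v) 0 0 = qform M v u * qform M u v.
    rewrite uM (_ : _ *m v = (v^T *m M *m u) *m (u^T *m M *m v)); last first.
      by rewrite !mulmxA.
    by rewrite mxE big_ord1.
  rewrite /M' mulmxBr mulmxBl -scalemxAr -scalemxAl.
  have entry (S Q : 'M[R]_1) c : (S - c *: Q) 0 0 = S 0 0 - c * Q 0 0 by rewrite !mxE.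
  rewrite entry key -/(qform M v v).
  rewrite (qformC u v MT) subr_ge0 ler_pdivrMl// -expr2 mulrC.
  exact: psd_cauchy_schwarz.
have sub : (M' <= M)%MS.
  apply/submxP; exists (1%:M - (qform M u u)^-1 *: (M *m u *m u^T)).
  by rewrite mulmxBl mul1mx -scalemxAl /M' uM !mulmxA.
have : (M' < M)%MS.
  rewrite ltmxE sub /=; apply/negP => /submxP[X MX].
  have Mu0 : M *m u = 0 by rewrite MX -mulmxA MuK mulmx0.
  by move: qp; rewrite /qform -mulmxA Mu0 mulmx0 mxE ltxx.
by rewrite ltmxErank => /andP[].
Qed.

(** The kernel of [B *m B^T] is contained in that of [M], so that [M *m u] has a
    preimage [w] under [B] of the form [B^T *m y]; for this preimage the
    Cauchy-Schwarz inequality reads [|w|^4 <= |w|^2]. *)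
Lemma psd_range d q (B : 'M[R]_(d, q)) (M : 'M[R]_d) (u : 'cV[R]_d) :
  psdmx M -> psd_le M (B *m B^T) -> 0 < qform M u u ->
  exists w : 'cV[R]_q, (w^T *m w) 0 0 <= 1 /\
    B *m w *m (B *m w)^T = (qform M u u)^-1 *: (M *m u *m (M *m u)^T).
Proof.
move=> pM [_ MS] qp; set S := B *m B^T in MS.
have [MT M0] := pM.
have MS' y : qform M y y <= qform S y y.
  by rewrite -subr_ge0; have := MS y; rewrite mulmxBr mulmxBl mxE [X in _ + X]mxE.
have /submxP[Y MY] : (M <= S)%MS.
  rewrite submxE; apply/eqP/matrixP => i j; rewrite [RHS]mxE.
  pose y := col j (cokermx S).
  have Sy : S *m y = 0 by rewrite /y colE mulmxA mulmx_coker mul0mx.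
  have : M *m y = 0.
    apply: psd_kernel => //; apply/eqP; rewrite eq_le M0 andbT.
    by apply: le_trans (MS' y) _; rewrite /qform -mulmxA Sy mulmx0 mxE.
  by rewrite /y colE mulmxA -colE => /matrixP/(_ i 0); rewrite !mxE.
have ST : S^T = S by rewrite trmx_mul trmxK.
pose c := Num.sqrt (qform M u u)^-1.
have c2 : c ^+ 2 = (qform M u u)^-1 by rewrite sqr_sqrtr// invr_ge0 ltW.
pose y := c *: (Y^T *m u).
have Sy : S *m y = c *: (M *m u).
  by rewrite -scalemxAr mulmxA -[in RHS]MT MY trmx_mul ST.
exists (B^T *m y).
have Bw : B *m (B^T *m y) = c *: (M *m u) by rewrite mulmxA.
split; last first.
  by rewrite Bw [(c *: _)^T]linearZ /= -scalemxAl -scalemxAr scalerA -expr2 c2.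
rewrite trmx_mul trmxK -mulmxA Bw.
have nE : (y^T *m (c *: (M *m u))) 0 0 = qform S y y.
  by rewrite -Sy mulmxA.
have nE' : (y^T *m (c *: (M *m u))) 0 0 = c * qform M y u.
  by rewrite -scalemxAr mulmxA mxE.
rewrite nE; have h : qform S y y ^+ 2 <= qform S y y.
  rewrite -{1}nE nE' exprMn c2 mulrC ler_pdivrMr//.
  by apply: le_trans (psd_cauchy_schwarz y u pM) _; rewrite ler_pM2r.
have [//|g1] := leP (qform S y y) 1.
by move: h; rewrite expr2 leNgt -subr_gt0 -{3}(mulr1 (qform S y y)) -mulrBr mulr_gt0// ?subr_gt0// (lt_trans ltr01).
Qed.

Section invariant_convex.
Variables (d q : nat) (h : 'M[R]_(d, q) -> R).
Hypotheses (ch : is_convex h)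
  (hO : forall A (O : 'M[R]_q), orthogonal_mx O -> h (A *m O) = h A).

(** [B *m rank1 k w] is a barycentre of [B] and of its image by the Householder
    reflection along [w], at which [h] takes the same value; [k] is chosen so that
    the square of [rank1 k w] is [rank1 1 w]. *)
Lemma le_deflate (B : 'M[R]_(d, q)) (w : 'cV[R]_q) : (w^T *m w) 0 0 <= 1 ->
  exists2 B' : 'M[R]_(d, q),
    B' *m B'^T = B *m B^T - B *m w *m (B *m w)^T & h B' <= h B.
Proof.
set n := (w^T *m w) 0 0 => n1.
have n0 : 0 <= n by exact: sqnorm_ge0.
have [nz|nz] := eqVneq n 0.
  have w0 : w = 0 by apply/eqP; rewrite -sqnorm_eq0 -/n nz.
  by exists B; rewrite // w0 mulmx0 mul0mx subr0.
have np : 0 < n by rewrite lt_def nz.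
pose s := Num.sqrt (1 - n).
have s0 : 0 <= s by exact: sqrtr_ge0.
have s2 : s ^+ 2 = 1 - n by rewrite sqr_sqrtr// subr_ge0.
have s1 : s <= 1 by rewrite -(@ler_pXn2r _ 2)// ?nnegrE// s2 expr1n; lra.
pose k := (1 - s) / n.
exists (B *m rank1 k w).
  rewrite trmx_mul tr_rank1 mulmxA -(mulmxA B) rank1_sqr -/n.
  rewrite (_ : 2 * k - k ^+ 2 * n = 1).
    by rewrite /rank1 scale1r mulmxBr mulmxBl mulmx1 trmx_mul !mulmxA.
  rewrite (_ : _ - _ = (1 - s ^+ 2) / n); last by rewrite /k; field.
  by rewrite s2 opprB addrC subrK divff.
pose a := (1 + s) / 2.
have a01 : 0 <= a <= 1 by rewrite /a; lra.
have -> : B *m rank1 k w = a *: B + (1 - a) *: (B *m rank1 (2 / n) w).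
  rewrite /rank1 !mulmxBr mulmx1 -!scalemxAr; move: (B *m _) => Q.
  by apply/matrixP => i j; rewrite !mxE /a /k; field.
apply: le_trans (ch _ _ a01) _; rewrite hO; last exact: orthogonal_rank1.
by rewrite -mulrDl addrC subrK mul1r.
Qed.

(** Such an [h] depends on [A *m A^T] only, and the domination of two Gram
    matrices is a finite succession of rank one deflations. *)
Lemma le_psd_le (A B : 'M[R]_(d, q)) :
  psd_le (A *m A^T) (B *m B^T) -> h A <= h B.
Proof.
pose r (B : 'M[R]_(d, q)) := \rank (B *m B^T - A *m A^T).
have [N] := ubnP (r B); elim: N B => // N IH {}B rN pM.
have [M0|M0] := eqVneq (B *m B^T - A *m A^T) 0.
  have [ O hO' ->] : exists2 O : 'M[R]_q, orthogonal_mx O & A = B *m O.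
    by apply: gram_eq_orthogonal; apply/eqP; rewrite -subr_eq0 M0.
  by rewrite hO.
have [u qu [pM' rM']] := psd_deflate pM M0.
have MB : psd_le (B *m B^T - A *m A^T) (B *m B^T).
  by rewrite /psd_le subKr; exact: psd_gram.
have [w [w1 wE]] := psd_range pM MB qu.
have [B' B'E hB'] := le_deflate B w1.
have e : B' *m B'^T - A *m A^T = B *m B^T - A *m A^T - B *m w *m (B *m w)^T.
  by rewrite B'E addrAC.
apply: le_trans hB'; apply: IH; last by rewrite /psd_le e wE.
by rewrite /r e wE; apply: leq_trans rM' _; rewrite -ltnS.
Qed.

End invariant_convex.
End psd_comparison.

(** * Measurability in matrix spaces *)

Section borel_matrix.
Context {R : realType} {m p : nat}.

Lemma continuous_measurable_mx (f : 'M[R]_(m, p) -> R) :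
  continuous f -> measurable_fun setT f.
Proof.
move=> /continuousP cf; apply: (measurability _ (RGenOpens.measurableE R)).
move=> _ [_ [a [b ->]] <-]; rewrite setTI; apply: sub_sigma_algebra.
exact/cf/interval_open.
Qed.

Lemma measurable_entry (i : 'I_m) (j : 'I_p) :
  measurable_fun setT (fun x : 'M[R]_(m, p) => x i j).
Proof. by apply: continuous_measurable_mx => x; exact: coord_continuous. Qed.

(** An open set of matrices is the union of the balls with rational entries and
    radius that it contains. *)
Lemma measurable_mx {dS} {S : measurableType dS} (X : S -> 'M[R]_(m, p)) :
  (forall i j, measurable_fun setT (fun w => X w i j)) -> measurable_fun setT X.
Proof.
move=> mX; apply: (measurability (@open 'M[R]_(m, p))) => // _ [V oV <-].
rewrite setTI.
pose c (k : 'M[rat]_(m, p) * rat) : 'M[R]_(m, p) := map_mx ratr k.1.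
pose B k := [set y : 'M[R]_(m, p) | forall i j, `|y i j - c k i j| < ratr k.2].
pose F k := if pselect (B k `<=` V) then X @^-1` B k else set0.
have mB k : measurable (X @^-1` B k).
  have -> : X @^-1` B k = \bigcap_(ij in [set: 'I_m * 'I_p])
      ([set w | `|X w ij.1 ij.2 - c k ij.1 ij.2| < ratr k.2]).
    apply/seteqP; split=> [w Bw [i j] _|w Bw i j]; first exact: Bw.
    exact: (Bw (i, j) I).
  apply: fin_bigcap_measurable => [|[i j] _] /=; first exact: finite_finset.
  have mb : measurable_fun setT (fun w => `|X w i j - c k i j| < ratr k.2 :> R).
    apply: measurable_fun_ltr => //; apply: measurableT_comp => //.
    exact: measurable_funB.
  by have := mb measurableT [set true] I; rewrite setTI.
have -> : X @^-1` V = \bigcup_k F k.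
  apply/seteqP; split=> [w Vw|w [k _]]; last first.
    by rewrite /F; case: pselect => // BV /BV.
  have := oV; rewrite openE => /(_ _ Vw); rewrite /interior.
  move=> /nbhs_ballP[e /= e0 eV].
  have [r /andP[r0 re]] : exists r : rat, (0 < (ratr r : R)) && (ratr r < e / 2).
    have e2 : 0 < e / 2 by rewrite divr_gt0.
    have [r] := rat_in_itvoo e2; rewrite in_itv /= => h.
    by exists r.
  have hq i j : exists q : rat, `|X w i j - ratr q| < ratr r.
    have h : X w i j - ratr r < X w i j + ratr r by lra.
    have [s] := rat_in_itvoo h; rewrite in_itv /= => /andP[h1 h2].
    by exists s; rewrite ltr_distlC; apply/andP; split; lra.
  pose Q : 'M[rat]_(m, p) := \matrix_(i, j) xget 0 [set q : rat | `|X w i j - ratr q| < ratr r].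
  have QP i j : `|X w i j - ratr (Q i j)| < ratr r.
    rewrite mxE; exact: (xgetPex 0 (hq i j)).
  exists (Q, r) => //; rewrite /F; case: pselect => [|nV] /=.
    by move=> _ i j; rewrite /c /= [map_mx _ _ _ _]mxE; exact: QP.
  exfalso; apply: nV => y By; apply: eV; split => // i j /=.
  have := QP i j; have := By i j; rewrite /c /= [map_mx _ _ _ _]mxE => h1 h2.
  rewrite /ball /= /ball_.
  have -> : X w i j - y i j = (X w i j - ratr (Q i j)) - (y i j - ratr (Q i j)) by ring.
  by apply: le_lt_trans (ler_normB _ _) _; lra.
apply: countable_bigcupT_measurable => [|k]; first exact: countableP.
by rewrite /F; case: pselect => [BV|BV] /=; [exact: mB | exact: measurable0].
Qed.

Lemma measurable_mxP {dS} {S : measurableType dS} (X : S -> 'M[R]_(m, p)) :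
  measurable_fun setT X <-> forall i j, measurable_fun setT (fun w => X w i j).
Proof.
split=> [mX i j|]; last exact: measurable_mx.
exact: (measurableT_comp (measurable_entry i j) mX).
Qed.

Lemma convex_measurable (f : 'M[R]_(m, p) -> R) :
  is_convex f -> measurable_fun setT f.
Proof. by move=> cf; apply: continuous_measurable_mx; exact: convex_continuous. Qed.

End borel_matrix.

(** * Expectations of bounded functions, independence *)

Section bounded_expectation.
Context {dT : measure_display} {T : measurableType dT} {R : realType}.
Variable P : probability T R.
Implicit Types f g : T -> R.

(** All expectations below are of such functions, hence finite. *)
Definition bounded_meas f :=
  measurable_fun setT f /\ exists C, forall w, `|f w| <= C.

Definition expect f : R := \int[P]_w f w.

Lemma bounded_meas_integrable f :
  bounded_meas f -> P.-integrable setT (EFin \o f).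
Proof.
case=> mf [C fC]; apply: measurable_bounded_integrable => //.
  by apply: le_lt_trans (probability_le1 P measurableT) _; rewrite ltry.
exists C; split; first by rewrite realE; case: (leP 0 C) => // /ltW ->.
by move=> x Cx w _; apply: le_trans (fC w) (ltW Cx).
Qed.

Lemma expectationE f : bounded_meas f -> ('E_P[f] = (expect f)%:E)%E.
Proof.
move=> /bounded_meas_integrable fi.
by rewrite /expect /Rintegral unlock fineK//; exact: integrable_fin_num.
Qed.

Lemma bounded_meas_cst c : bounded_meas (cst c).
Proof. by split; [exact: measurable_cst | exists `|c|]. Qed.

Lemma bounded_measD f g :
  bounded_meas f -> bounded_meas g -> bounded_meas (fun w => f w + g w).
Proof.
move=> [mf [C fC]] [mg [D gD]]; split; first exact: measurable_funD.
by exists (C + D) => w; apply: le_trans (ler_normD _ _) (lerD _ _).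
Qed.

Lemma bounded_measM f g :
  bounded_meas f -> bounded_meas g -> bounded_meas (fun w => f w * g w).
Proof.
move=> [mf [C fC]] [mg [D gD]]; split; first exact: measurable_funM.
by exists (C * D) => w; rewrite normrM ler_pM.
Qed.

Lemma bounded_measZ c f : bounded_meas f -> bounded_meas (fun w => c * f w).
Proof. by move=> bf; apply: bounded_measM => //; exact: bounded_meas_cst. Qed.

Lemma bounded_measB f g :
  bounded_meas f -> bounded_meas g -> bounded_meas (fun w => f w - g w).
Proof.
move=> bf /(bounded_measZ (-1)) bg; have := bounded_measD bf bg.
by under eq_fun do rewrite mulN1r.
Qed.

Lemma bounded_meas_sum (I : Type) (s : seq I) (F : I -> T -> R) :
  (forall i, bounded_meas (F i)) -> bounded_meas (fun w => \sum_(i <- s) F i w).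
Proof.
move=> bF; elim: s => [|i s IH].
  by under eq_fun do rewrite big_nil; exact: bounded_meas_cst.
by under eq_fun do rewrite big_cons; exact: bounded_measD.
Qed.

Lemma expect_cst c : expect (cst c) = c.
Proof.
rewrite /expect Rintegral_cst// -[RHS]mulr1; congr (_ * _).
by transitivity (fine (1%:E : \bar R)); [congr fine; exact: probability_setT|].
Qed.

Lemma expectD f g : bounded_meas f -> bounded_meas g ->
  expect (fun w => f w + g w) = expect f + expect g.
Proof. by move=> bf bg; apply: RintegralD => //; exact: bounded_meas_integrable. Qed.

Lemma expectZ c f : bounded_meas f -> expect (fun w => c * f w) = c * expect f.
Proof. by move=> bf; apply: RintegralZl => //; exact: bounded_meas_integrable. Qed.

Lemma expectB f g : bounded_meas f -> bounded_meas g ->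
  expect (fun w => f w - g w) = expect f - expect g.
Proof. by move=> bf bg; apply: RintegralB => //; exact: bounded_meas_integrable. Qed.

Lemma expect_sum (I : Type) (s : seq I) (F : I -> T -> R) :
  (forall i, bounded_meas (F i)) ->
  expect (fun w => \sum_(i <- s) F i w) = \sum_(i <- s) expect (F i).
Proof.
move=> bF; elim: s => [|i s IH].
  rewrite big_nil -[RHS](expect_cst 0); congr expect.
  by apply/funext => w; rewrite big_nil.
rewrite big_cons -IH -expectD//; last exact: bounded_meas_sum.
by congr expect; apply/funext => w; rewrite big_cons.
Qed.

Lemma le_expect f g : bounded_meas f -> bounded_meas g ->
  (forall w, f w <= g w) -> expect f <= expect g.
Proof. by move=> bf bg fg; apply: le_Rintegral => //; exact: bounded_meas_integrable. Qed.

Lemma expect_ge0E f : bounded_meas f -> (forall w, 0 <= f w) ->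
  (\int[P]_w (f w)%:E = (expect f)%:E)%E.
Proof.
by move=> /bounded_meas_integrable fi _; rewrite /expect /Rintegral fineK//; exact: integrable_fin_num.
Qed.

Lemma ae_le_expect f g : bounded_meas f -> bounded_meas g ->
  {ae P, forall w, f w <= g w} -> expect f <= expect g.
Proof.
move=> bf bg fg; have [mf [C fC]] := bf; have [mg [D gD]] := bg.
pose c := Num.max C D.
have c0 (h : T -> R) E : (forall w, `|h w| <= E) -> E <= c -> forall w, 0 <= h w + c.
  by move=> hE Ec w; have := le_trans (hE w) Ec; rewrite ler_norml => /andP[]; lra.
have bc := bounded_meas_cst c.
have f0 : forall w, 0 <= f w + c by apply: (c0 _ C) => //; rewrite le_max lexx.
have g0 : forall w, 0 <= g w + c by apply: (c0 _ D) => //; rewrite le_max lexx orbT.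
have bfc := bounded_measD bf bc; have bgc := bounded_measD bg bc.
suff : expect (fun w => f w + cst c w) <= expect (fun w => g w + cst c w).
  by rewrite !expectD// lerD2r.
rewrite -lee_fin -!expect_ge0E//; apply: ae_ge0_le_integral => //.
- by move=> w _; rewrite lee_fin; exact: f0.
- by case: bfc => ? _; apply/measurable_EFinP.
- by move=> w _; rewrite lee_fin; exact: g0.
- by case: bgc => ? _; apply/measurable_EFinP.
- case: fg => N [mN N0 fgN]; exists N; split => // w /= h; apply: fgN => /= fgw.
  by apply: h => _; rewrite lee_fin lerD2r.
Qed.

End bounded_expectation.

Section laws.
Context {dT : measure_display} {T : measurableType dT} {R : realType}.
Variable P : probability T R.

(** Clipping [h] at the bound [C] turns it into a function to which the
    integration theory of nonnegative functions applies after a shift. *)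
Lemma expect_eq_law {dE} {E : measurableType dE} (X Y : T -> E) (h : E -> R) (C : R) :
  measurable_fun setT X -> measurable_fun setT Y ->
  (forall B, measurable B -> P (X @^-1` B) = P (Y @^-1` B)) ->
  measurable_fun setT h -> (forall w, `|h (X w)| <= C) ->
  (forall w, `|h (Y w)| <= C) ->
  expect P (h \o X) = expect P (h \o Y).
Proof.
move=> mX mY XY mh hX hY.
pose g z := Num.max (- C) (Num.min C (h z)) + C.
have mg : measurable_fun setT g.
  apply: measurable_funD => //; apply: measurable_maxr => //.
  exact: measurable_minr.
have g0 z : 0 <= g z by rewrite -lerBlDr sub0r le_max lexx.
have gE (V : T -> E) : (forall w, `|h (V w)| <= C) -> forall w, g (V w) = h (V w) + C.
  move=> hV w; rewrite /g; have := hV w; rewrite ler_norml => /andP[h1 h2].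
  by rewrite min_r// max_r.
have key (V : T -> E) : measurable_fun setT V -> (forall w, `|h (V w)| <= C) ->
    (\int[pushforward P V]_y (g y)%:E = (expect P (h \o V) + C)%:E)%E.
  move=> mV hV; rewrite ge0_integral_pushforward//; last 2 first.
  - exact/measurable_EFinP.
  - by move=> y _; rewrite lee_fin.
  rewrite preimage_setT; have bV : bounded_meas (h \o V).
    by split; [exact: measurableT_comp | exists C].
  have bc := bounded_meas_cst (T := T) C.
  rewrite -[W in _ + W](expect_cst P C) -expectD// -expect_ge0E.
  - by apply: eq_integral => w _ /=; rewrite gE.
  - exact: bounded_measD.
  - by move=> w /=; rewrite -gE.
have : (expect P (h \o X) + C)%:E = (expect P (h \o Y) + C)%:E.
  rewrite -!key//; apply: eq_measure_integral => A mA _; exact: XY.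
by move=> [] /addIr.
Qed.

Definition indep_rv {d1 d2} {E1 : measurableType d1} {E2 : measurableType d2}
    (X : T -> E1) (Y : T -> E2) :=
  forall A B, measurable A -> measurable B ->
  P (X @^-1` A `&` Y @^-1` B) = (P (X @^-1` A) * P (Y @^-1` B))%E.

(** Independence allows integrating first over [Y] with [X] frozen. The bound on
    [h] is only required on the ranges, where a convex [h] is bounded. *)
Lemma expect_freeze {d1 d2} {E1 : measurableType d1} {E2 : measurableType d2}
    (X : T -> E1) (Y : T -> E2) (h : E1 * E2 -> R) (C : R) :
  measurable_fun setT X -> measurable_fun setT Y -> indep_rv X Y ->
  measurable_fun setT h -> (forall w w', `|h (X w, Y w')| <= C) ->
  bounded_meas (fun w => expect P (fun w' => h (X w, Y w'))) /\
  expect P (fun w => h (X w, Y w)) =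
    expect P (fun w => expect P (fun w' => h (X w, Y w'))).
Proof.
move=> mX mY XY mh hC.
pose g z := Num.max (- C) (Num.min C (h z)) + C.
have mg : measurable_fun setT g.
  apply: measurable_funD => //; apply: measurable_maxr => //.
  exact: measurable_minr.
have g0 z : 0 <= g z by rewrite -lerBlDr sub0r le_max lexx.
have gE w w' : g (X w, Y w') = h (X w, Y w') + C.
  rewrite /g; have := hC w w'; rewrite ler_norml => /andP[h1 h2].
  by rewrite min_r// max_r.
have mge : measurable_fun setT (EFin \o g) by exact/measurable_EFinP.
pose X' : {mfun T >-> E1} := mfun_Sub (mem_set mX).
pose Y' : {mfun T >-> E2} := mfun_Sub (mem_set mY).
have bc := bounded_meas_cst (T := T) C.
have mXY : measurable_fun setT (fun w => (X w, Y w)).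
  exact: (measurable_fun_pair mX mY).
have bY w : bounded_meas (fun w' => h (X w, Y w')).
  split; last by exists C.
  exact: measurableT_comp mh (measurable_fun_pair (measurable_cst (X w)) mY).
pose F x := (\int[distribution P Y']_y (g (x, y))%:E)%E.
have FE w : F (X w) = (expect P (fun w' => h (X w, Y w')) + C)%:E.
  have mgx : measurable_fun setT (fun y => (g (X w, y))%:E).
    apply/measurable_EFinP; apply: (measurableT_comp mg).
    exact: (measurable_fun_pair (measurable_cst (X w)) (@measurable_id _ _ setT)).
  rewrite /F ge0_integral_distribution//=; last by move=> y; rewrite lee_fin.
  rewrite -[W in _ + W](expect_cst P C) -expectD// -expect_ge0E.
  - by apply: eq_integral => w' _ /=; rewrite gE.
  - exact: bounded_measD.
  - by move=> w' /=; rewrite -gE.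
have mF : measurable_fun setT F.
  exact: (@measurable_fun_fubini_tonelli_F _ _ _ _ _ (distribution P Y') _ mge).
have bE : bounded_meas (fun w => expect P (fun w' => h (X w, Y w'))).
  split.
    have : measurable_fun setT (fun w => fine (F (X w)) - C).
      apply: measurable_funB => //; apply: measurableT_comp => //.
      exact: measurableT_comp.
    by under eq_fun do rewrite FE /= addrK.
  exists C => w; rewrite ler_norml; apply/andP; split;
    [rewrite -[leLHS](expect_cst P (- C)) | rewrite -[leRHS](expect_cst P C)];
    apply: le_expect => //; try exact: bounded_meas_cst;
    by move=> w'; have := hC w w'; rewrite ler_norml => /andP[].
split=> //.
have shift f : bounded_meas f -> (forall w, 0 <= f w + C) ->
    (\int[P]_w (f w + C)%:E = (expect P f + C)%:E)%E.
  move=> bf f0; rewrite -[W in _ = (_ + W)%:E](expect_cst P C) -expectD//.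
  by rewrite -expect_ge0E//; exact: bounded_measD.
have bXY : bounded_meas (fun w => h (X w, Y w)).
  by split; [exact: measurableT_comp mh mXY | exists C].
have : (expect P (fun w => h (X w, Y w)) + C)%:E =
    (expect P (fun w => expect P (fun w' => h (X w, Y w'))) + C)%:E.
  transitivity (\int[pushforward P (fun w => (X w, Y w))]_z (g z)%:E)%E.
    rewrite ge0_integral_pushforward//; last by move=> y _; rewrite lee_fin.
    rewrite preimage_setT -shift//; last by move=> w; rewrite -gE.
    by apply: eq_integral => w _ /=; rewrite gE.
  transitivity (\int[distribution P X' \x distribution P Y']_z (g z)%:E)%E.
    apply: eq_measure_integral => A mA _; apply/esym.
    by apply: product_measure_unique => // A1 A2 mA1 mA2; exact: XY.
  rewrite (fubini_tonelli1 _ mge); last by move=> z; rewrite lee_fin.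
  rewrite ge0_integral_distribution//=; last first.
    by move=> x; apply: integral_ge0 => y _; rewrite lee_fin.
  rewrite -shift//; last first.
    move=> w; rewrite -lee_fin -FE.
    by apply: integral_ge0 => y _; rewrite lee_fin.
  by apply: eq_integral => w _ /=; rewrite -FE.
by move=> [] /addIr.
Qed.

End laws.

(** * Independence from the past *)

Section past.
Context {dT : measure_display} {T : measurableType dT} {R : realType}.
Variable P : probability T R.
Variables (S : finType) (G : S -> set (set T)).
Implicit Types (J K : pred S).
Hypotheses (GT : forall i, G i setT)
  (GI : forall i A B, G i A -> G i B -> G i (A `&` B))
  (Gm : forall i, G i `<=` measurable)
  (indG : forall A : S -> set T, (forall i, G i (A i)) ->
    P (\bigcap_i A i) = (\prod_i P (A i))%E).

(** A family stable under intersection that generates the information carried by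
    the sources in [J]. *)
Definition boxes (J : pred S) : set (set T) :=
  [set B | exists2 A : S -> set T,
    (forall i, G i (A i)) /\ (forall i, ~~ J i -> A i = setT) &
    B = \bigcap_i A i].

Definition past_measurable (J : pred S) {dE} {E : measurableType dE} (X : T -> E) :=
  measurable_fun [set: g_sigma_algebraType (boxes J)] X.

Lemma boxes_setI J : setI_closed (boxes J).
Proof.
move=> _ _ [A [GA JA] ->] [B [GB JB] ->]; exists (fun i => A i `&` B i).
  by split=> i; [exact: GI | move=> Ji; rewrite JA// JB// setTI].
by rewrite bigcapI.
Qed.

Lemma boxes_measurable J : boxes J `<=` measurable.
Proof.
move=> _ [A [GA _] ->]; apply: fin_bigcap_measurable; first exact: finite_finset.
by move=> i _; exact: Gm.
Qed.

Lemma past_measurable_fun J dE (E : measurableType dE) (X : T -> E) :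
  past_measurable J X -> measurable_fun setT X.
Proof.
move=> mX _ B mB; rewrite setTI.
have : <<s boxes J >> (X @^-1` B) by have := mX measurableT B mB; rewrite setTI.
apply: smallest_sub; first exact: sigma_algebra_measurable.
exact: boxes_measurable.
Qed.

Lemma past_measurableS J K dE (E : measurableType dE) (X : T -> E) :
  (forall i, J i -> K i) -> past_measurable J X -> past_measurable K X.
Proof.
move=> JK mX _ B mB.
have : <<s boxes J >> (setT `&` X @^-1` B) by exact: mX.
apply: sub_sigma_algebra2 => _ [A [GA JA] ->]; exists A => //; split=> // i Ki.
by apply: JA; apply: contra Ki; exact: JK.
Qed.

Lemma bigcap_single (j : S) (D : set T) :
  \bigcap_i (if i == j then D else setT) = D.
Proof.
apply/seteqP; split=> [w /(_ j I)|w Dw i _]; first by rewrite eqxx.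
by case: ifP.
Qed.

Lemma past_measurable_coord (J : pred S) j dE (E : measurableType dE) (X : T -> E) :
  J j -> sigma_of X `<=` G j -> past_measurable J X.
Proof.
move=> Jj XG _ B mB; apply: sub_sigma_algebra; rewrite setTI.
exists (fun i => if i == j then X @^-1` B else setT); last by rewrite bigcap_single.
split=> i; case: ifPn => // /eqP ->; last by rewrite Jj.
by apply: XG; exists B => //; rewrite setTI.
Qed.

(** Both sides are finite measures in [B], and they agree on boxes, where this is
    the product rule for one more side. *)
Lemma past_indep (J : pred S) j (B D : set T) :
  ~~ J j -> <<s boxes J >> B -> G j D -> P (B `&` D) = (P B * P D)%E.
Proof.
move=> Jj JB GD.
have mD : measurable D by exact: (Gm GD).
have PDfin : P D \is a fin_num by exact: fin_num_measure.
pose r : {nonneg R} := NngNum (fine_ge0 (measure_ge0 P D)).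
have rE : (r%:num)%:E = P D by rewrite /= fineK.
pose m1 := mrestr P mD.
pose m2 := mscale r P.
suff : m1 B = m2 B by rewrite /m2 /= /mscale rE muleC.
have boxE A : boxes J A -> P (A `&` D) = (P D * P A)%E.
  move=> [C [GC JC] ->].
  pose C' i := if i == j then D else C i.
  have -> : \bigcap_i C i `&` D = \bigcap_i C' i.
    apply/seteqP; split=> [w [Cw Dw] i _|w Cw].
      by rewrite /C'; case: ifP => // _; exact: Cw.
    split=> [i _|]; last by have := Cw j I; rewrite /C' eqxx.
    have := Cw i I; rewrite /C'; case: ifPn => // /eqP -> _.
    by rewrite JC.
  have GC' i : G i (C' i) by rewrite /C'; case: eqP => // ->.
  rewrite (indG GC') (indG GC) (bigD1 j)//= [in RHS](bigD1 j)//= /C' eqxx JC//.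
  rewrite probability_setT mul1e; congr (_ * _)%E.
  by apply: eq_bigr => i /negbTE ->.
have H := @g_sigma_algebra_measure_unique_trace _ R T (boxes J) setT measurableT.
have e : [set X | boxes J X /\ X `<=` setT] = boxes J.
  by apply/seteqP; split=> [X []|X bX].
rewrite e in H; apply: H => //.
- exact: boxes_measurable.
- exact: boxes_setI.
- rewrite /m2 /= /mscale rE; apply: boxE; exists (fun=> setT) => //.
  by apply/seteqP; split.
- by move=> A /boxE; rewrite /m2 /= /mscale rE.
- by rewrite /mrestr; apply: le_lt_trans (probability_le1 P _) _; rewrite ?ltry//; exact: measurableI.
Qed.

Lemma past_indep_rv (J : pred S) j d1 d2 (E1 : measurableType d1)
    (E2 : measurableType d2) (X : T -> E1) (Y : T -> E2) :
  ~~ J j -> past_measurable J X -> sigma_of Y `<=` G j -> indep_rv P X Y.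
Proof.
move=> Jj mX YG A B mA mB; apply: (past_indep Jj).
  by have := mX measurableT A mA; rewrite setTI.
by apply: YG; exists B => //; rewrite setTI.
Qed.

End past.

Section three_sources.
Context {dT : measure_display} {T : measurableType dT} {R : realType}.
Variables (P : probability T R) (n : nat).
Variables (F0 : set (set T)) (F1 F2 : 'I_n -> set (set T)).

Definition sources (i : 'I_1 + ('I_n + 'I_n)) : set (set T) :=
  match i with inl _ => F0 | inr (inl i) => F1 i | inr (inr i) => F2 i end.

Lemma indep_sources :
  indep_family P F1 -> indep_family P F2 ->
  indep P F0 <<s \bigcup_(k in [set: 'I_n]) F1 k >> ->
  indep P <<s \bigcup_(k in [set: 'I_n]) F2 k >>
    <<s F0 `|` \bigcup_(k in [set: 'I_n]) F1 k >> ->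
  forall A, (forall i, sources i (A i)) -> P (\bigcap_i A i) = (\prod_i P (A i))%E.
Proof.
move=> ind1 ind2 ind01 ind201 A FA.
pose A0 := A (inl ord0).
pose A1 i := A (inr (inl i)).
pose A2 i := A (inr (inr i)).
have gen (H : set (set T)) (B : 'I_n -> set T) :
    (forall i, H (B i)) -> <<s H >> (\bigcap_i B i).
  move=> HB; apply: (@fin_bigcap_measurable _ (g_sigma_algebraType H)) => [|i _].
    exact: finite_finset.
  by apply: sub_sigma_algebra.
have -> : \bigcap_i A i = (\bigcap_i A2 i) `&` (A0 `&` \bigcap_i A1 i).
  apply/seteqP; split=> [w Aw|w [A2w [A0w A1w]] [i|[i|i]] _].
  - by split=> [i _|]; [|split=> [|i _]]; exact: Aw.
  - by rewrite (ord1 i).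
  - exact: A1w.
  - exact: A2w.
rewrite ind201; last 2 first.
- apply: gen => i; exists i => //; exact: (FA (inr (inr i))).
- apply: (@measurableI _ (g_sigma_algebraType (F0 `|` \bigcup_(k in [set: 'I_n]) F1 k))).
    by apply: sub_sigma_algebra; left; exact: (FA (inl ord0)).
  by apply: gen => i; right; exists i => //; exact: (FA (inr (inl i))).
rewrite ind01; last 2 first.
- exact: (FA (inl ord0)).
- by apply: gen => i; exists i => //; exact: (FA (inr (inl i))).
have ind (F : 'I_n -> set (set T)) (B : 'I_n -> set T) : indep_family P F ->
    (forall i, F i (B i)) -> P (\bigcap_i B i) = (\prod_i P (B i))%E.
  move=> iF FB; have := iF [set: 'I_n]%SET B (fun i _ => FB i).
  rewrite (_ : [set` [set: 'I_n]%SET] = setT); last first.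
    by apply/seteqP; split=> // i _ /=; rewrite inE.
  by move=> ->; apply: eq_bigl => i; rewrite inE.
rewrite (ind _ A1 ind1 (fun i => FA (inr (inl i)))).
rewrite (ind _ A2 ind2 (fun i => FA (inr (inr i)))).
rewrite [RHS]big_sumType /= big_ord1 [X in (_ = _ * X)%E]big_sumType /=.
by rewrite muleC -muleA.
Qed.

End three_sources.

(** * Bounded random vectors and radial noises *)

Section bounded_vectors.
Context {dT : measure_display} {T : measurableType dT} {R : realType}.
Variable P : probability T R.

Definition bounded_vec {m p} (X : T -> 'M[R]_(m, p)) :=
  measurable_fun setT X /\ exists C, forall w, `|X w| <= C.

Lemma bounded_vecP m p (X : T -> 'M[R]_(m, p)) :
  bounded_vec X <-> forall i j, bounded_meas (fun w => X w i j).
Proof.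
split=> [[mX [C XC]] i j|bX].
  split; first by move/measurable_mxP: mX; exact.
  by exists C => w; apply: le_trans (mx_norm_entry _ _ _) (XC w).
split; first by apply/measurable_mxP => i j; case: (bX i j).
pose K i j := xget 0 [set C | forall w, `|X w i j| <= C].
have KP i j w : `|X w i j| <= K i j.
  by have [_ h] := bX i j; exact: (xgetPex 0 h).
exists (\sum_i \sum_j `|K i j|) => w; apply: mx_norm_le.
  by apply: sumr_ge0 => i _; apply: sumr_ge0 => j _.
move=> i j; apply: le_trans (KP i j w) _; apply: le_trans (ler_norm _) _.
rewrite (bigD1 i)//= (bigD1 j)//= -addrA lerDl addr_ge0//.
  by apply: sumr_ge0 => k _.
by apply: sumr_ge0 => k _; apply: sumr_ge0 => l _.
Qed.

Lemma bounded_vec_mul m p q (A : 'M[R]_(m, p)) (X : T -> 'M[R]_(p, q)) :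
  bounded_vec X -> bounded_vec (fun w => A *m X w).
Proof.
move=> /bounded_vecP bX; apply/bounded_vecP => i j.
under eq_fun do rewrite mxE.
by apply: bounded_meas_sum => k; exact: bounded_measZ.
Qed.

Lemma bounded_vecD m p (X Y : T -> 'M[R]_(m, p)) :
  bounded_vec X -> bounded_vec Y -> bounded_vec (fun w => X w + Y w).
Proof.
move=> /bounded_vecP bX /bounded_vecP bY; apply/bounded_vecP => i j.
by under eq_fun do rewrite mxE; exact: bounded_measD.
Qed.

Lemma convex_bounded_meas m p (f : 'M[R]_(m, p) -> R) (X : T -> 'M[R]_(m, p)) :
  is_convex f -> bounded_vec X -> bounded_meas (fun w => f (X w)).
Proof.
move=> cf [mX [C XC]]; split.
  exact: measurableT_comp (convex_measurable cf) mX.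
by have [K HK] := convex_locally_bounded cf C; exists K => w; exact: HK.
Qed.

Lemma expect_convex m p q (f : 'M[R]_(m, q) -> R) (Z : T -> 'M[R]_(p, q)) :
  is_convex f -> bounded_vec Z ->
  is_convex (fun A : 'M[R]_(m, p) => expect P (fun w => f (A *m Z w))).
Proof.
move=> cf bZ a x y a01.
have bf A : bounded_meas (fun w => f (A *m Z w)).
  by apply: convex_bounded_meas => //; exact: bounded_vec_mul.
rewrite -!expectZ// -expectD; try exact: bounded_measZ.
apply: le_expect => [//||w]; first by apply: bounded_measD; exact: bounded_measZ.
by rewrite mulmxDl -!scalemxAl; exact: cf.
Qed.

End bounded_vectors.

Section transport.
Context {dT : measure_display} {T : measurableType dT} {R : realType}.
Variable P : probability T R.

(** The convexity property of a coefficient [th] relative to a noise [Z] that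
    makes one Euler step preserve convexity of the value function: up to
    replacing [th x] and [th y] by matrices producing the same law, the
    coefficient at a barycentre is dominated by the barycentre. *)
Definition convex_transport d q (Z : T -> 'cV[R]_q) (th : 'cV[R]_d -> 'M[R]_(d, q)) :=
  forall (x y : 'cV[R]_d) (a : R), 0 <= a <= 1 -> exists Bx By : 'M[R]_(d, q),
  [/\ forall f : 'cV[R]_d -> R, is_convex f ->
        expect P (fun w => f (Bx *m Z w)) = expect P (fun w => f (th x *m Z w)),
      forall f : 'cV[R]_d -> R, is_convex f ->
        expect P (fun w => f (By *m Z w)) = expect P (fun w => f (th y *m Z w)) &
      forall f : 'cV[R]_d -> R, is_convex f ->
        expect P (fun w => f (th (a *: x + (1 - a) *: y) *m Z w)) <=
        expect P (fun w => f ((a *: Bx + (1 - a) *: By) *m Z w))].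

Lemma radial_expect d q (Z : T -> 'cV[R]_q) (f : 'cV[R]_d -> R)
    (A : 'M[R]_(d, q)) (O : 'M[R]_q) :
  bounded_vec Z -> radial P Z -> is_convex f -> orthogonal_mx O ->
  expect P (fun w => f (A *m O *m Z w)) = expect P (fun w => f (A *m Z w)).
Proof.
move=> bZ rZ cf oO.
have bOZ := bounded_vec_mul O bZ.
have cA : is_convex (fun z : 'cV[R]_q => f (A *m z)).
  by apply: (is_convex_affine cf) => a x y; rewrite mulmxDr -!scalemxAr.
have [_ [C1 h1]] := convex_bounded_meas cA bZ.
have [_ [C2 h2]] := convex_bounded_meas cA bOZ.
rewrite -[RHS]/(expect P ((fun z => f (A *m z)) \o Z)).
rewrite -(@expect_eq_law _ _ _ P _ _ (fun w => O *m Z w) Z _ (Num.max C1 C2)).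
- by congr expect; apply/funext => w /=; rewrite mulmxA.
- by case: bOZ.
- by case: bZ.
- by move=> B mB; exact: rZ.
- exact: convex_measurable.
- by move=> w; rewrite le_max h2 orbT.
- by move=> w; rewrite le_max h1.
Qed.

Lemma radial_transport d q (Z : T -> 'cV[R]_q) (th : 'cV[R]_d -> 'M[R]_(d, q)) :
  bounded_vec Z -> radial P Z -> mx_convex th -> convex_transport Z th.
Proof.
move=> bZ rZ cth x y a a01.
have [ O oO le] := cth x y a a01.
exists (th x), (th y *m O); split=> // f cf; first exact: radial_expect.
apply: (le_psd_le (h := fun A => expect P (fun w => f (A *m Z w)))) => //.
  exact: expect_convex.
by move=> A Q oQ; exact: radial_expect.
Qed.

End transport.

(** * Diagonal coefficients *)

Section diagonal.
Context {dT : measure_display} {T : measurableType dT} {R : realType}.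
Variable P : probability T R.

Lemma is_convex_diag q (f : 'cV[R]_q -> R) (Z : T -> 'cV[R]_q) :
  is_convex f -> bounded_vec Z ->
  is_convex (fun a : 'rV[R]_q => expect P (fun w => f (diag_mx a *m Z w))).
Proof.
move=> cf bZ; apply: (is_convex_affine (expect_convex P cf bZ)) => a x y.
by rewrite linearD /= !linearZ.
Qed.

(** The coordinates of [a] are replaced by those of [b] one at a time. *)
Lemma coordinatewise_le q (h : 'rV[R]_q -> R) (r : R -> R -> Prop) :
  (forall (a b : 'rV[R]_q) i, (forall j, j != i -> a 0 j = b 0 j) ->
    r (a 0 i) (b 0 i) -> h a <= h b) ->
  forall a b : 'rV[R]_q, (forall i, r (a 0 i) (b 0 i)) -> h a <= h b.
Proof.
move=> hr a b rab.
pose c k : 'rV[R]_q := \row_j (if (j < k)%N then b 0 j else a 0 j).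
have c0 : c 0%N = a by apply/rowP => j; rewrite mxE.
have cq : c q = b by apply/rowP => j; rewrite mxE ltn_ord.
suff H k : (k <= q)%N -> h (c 0%N) <= h (c k) by rewrite -c0 -cq; exact: H.
elim: k => // k IH kq; apply: le_trans (IH (ltnW kq)) _.
apply: (hr _ _ (Ordinal kq)) => [j jk|].
  rewrite !mxE ltnS [(j <= k)%N]leq_eqVlt.
  by rewrite (negbTE (_ : (j != k :> nat))).
by rewrite !mxE /= ltnn ltnS leqnn.
Qed.

(** [r] is the domination of diagonal entries adapted to the noise; [u x] is an
    entrywise equivalent of the diagonal of [th x] that is convex in [x]: the
    diagonal itself or its absolute value. *)
Lemma diag_transport q (Z : T -> 'cV[R]_q) (th : 'cV[R]_q -> 'M[R]_q)
    (u : 'cV[R]_q -> 'rV[R]_q) (r : R -> R -> Prop) :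
  bounded_vec Z -> (forall x, is_diag_mx (th x)) ->
  (forall f : 'cV[R]_q -> R, is_convex f -> forall (a b : 'rV[R]_q) i,
    (forall j, j != i -> a 0 j = b 0 j) -> r (a 0 i) (b 0 i) ->
    expect P (fun w => f (diag_mx a *m Z w)) <=
    expect P (fun w => f (diag_mx b *m Z w))) ->
  (forall x i, r (th x i i) (u x 0 i) /\ r (u x 0 i) (th x i i)) ->
  (forall (x y : 'cV[R]_q) (a : R) i, 0 <= a <= 1 ->
    r (th (a *: x + (1 - a) *: y) i i) (a * u x 0 i + (1 - a) * u y 0 i)) ->
  convex_transport P Z th.
Proof.
move=> bZ dth hr ru rth x y a a01.
have thE z : th z = diag_mx (\row_i th z i i).
  apply/matrixP => i j; rewrite !mxE; case: eqP => [->|/eqP ij].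
    by rewrite mulr1n.
  by rewrite mulr0n; move/is_diag_mxP: (dth z); exact.
have uE z (f : 'cV[R]_q -> R) : is_convex f ->
    expect P (fun w => f (diag_mx (u z) *m Z w)) = expect P (fun w => f (th z *m Z w)).
  move=> cf; rewrite thE; apply/eqP; rewrite eq_le; apply/andP.
  by split; apply: (coordinatewise_le (hr f cf)) => i; rewrite mxE;
    case: (ru z i).
exists (diag_mx (u x)), (diag_mx (u y)); split=> [f|f|f cf]; try exact: uE.
rewrite thE.
rewrite (_ : a *: diag_mx (u x) + _ = diag_mx (a *: u x + (1 - a) *: u y)).
  apply: (coordinatewise_le (hr f cf)) => i.
  by rewrite [X in r X _]mxE [X in r _ X]mxE [X in r _ (X + _)]mxE [X in r _ (_ + X)]mxE; exact: rth.
by rewrite linearD /= !linearZ.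
Qed.

End diagonal.

(** * Jensen's inequality under vanishing conditional expectations *)

(** Off the interval between [0] and [1 / N] the convexity inequality gives this
    without the error term; inside it both increments are of order [1 / N]. *)
Lemma difference_quotient_le (R : realType) (phi : R -> R) (K : R) (N : nat) (s : R) :
  (forall a s1 s2, 0 <= a <= 1 ->
    phi (a * s1 + (1 - a) * s2) <= a * phi s1 + (1 - a) * phi s2) ->
  (0 < N)%N -> (forall t, `|t| <= 1 -> `|phi t| <= K) ->
  phi 0 + s * (N%:R * (phi N%:R^-1 - phi 0)) - 4 * K / N%:R <= phi s.
Proof.
move=> line N0 Kb.
have NR : 0 < N%:R :> R by rewrite ltr0n.
have N1 : N%:R^-1 <= 1 :> R by rewrite invf_le1// ler1n.
have K0 : 0 <= K by apply: le_trans (Kb 0 _); rewrite ?normr0.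
have bd t : `|t| <= 1 -> - K <= phi t <= K by move=> t1; rewrite -ler_norml Kb.
have KN : 0 <= K / N%:R by rewrite divr_ge0// ltW.
have k0 : - K <= phi 0 <= K by apply: bd; rewrite normr0.
set F := phi N%:R^-1; set f0 := phi 0 in k0 *; set fs := phi s.
have [s0|s0] := leP s 0.
  (* [0] lies between [s] and [1 / N] *)
  pose a := (1 - N%:R * s)^-1.
  have c1 : 1 <= 1 - N%:R * s by rewrite lerDl oppr_ge0 mulr_ge0_le0// ltW.
  have c0 : 0 < 1 - N%:R * s by lra.
  have a01 : 0 <= a <= 1 by rewrite invr_ge0 (ltW c0)/= invf_le1.
  have := line a s N%:R^-1 a01; rewrite -/F.
  rewrite (_ : a * s + (1 - a) * N%:R^-1 = 0); last by rewrite /a; field; rewrite !gt_eqF.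
  move=> h.
  have : (1 - N%:R * s) * f0 <= fs - N%:R * s * F.
    have -> : fs - N%:R * s * F = (1 - N%:R * s) * (a * fs + (1 - a) * F).
      by rewrite /a; field; rewrite gt_eqF.
    by rewrite ler_pM2l.
  lra.
have [sN|sN] := leP N%:R^-1 s.
  (* [1 / N] lies between [0] and [s] *)
  pose a := N%:R^-1 / s.
  have a01 : 0 <= a <= 1 by rewrite /a divr_ge0 ?(ltW s0) ?invr_ge0 ?(ltW NR)//= ler_pdivrMr// mul1r.
  have := line a s 0 a01; rewrite mulr0 addr0.
  rewrite (_ : a * s = N%:R^-1); last by rewrite divfK// gt_eqF.
  rewrite -/F => h.
  have : N%:R * s * F <= fs + (N%:R * s - 1) * f0.
    have -> : fs + (N%:R * s - 1) * f0 = N%:R * s * (a * fs + (1 - a) * f0).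
      by rewrite /a; field; rewrite !gt_eqF.
    by rewrite ler_pM2l// mulr_gt0.
  lra.
(* for [0 < s < 1 / N] both increments are of order [K / N] *)
have s1 : s <= 1 by lra.
have lo : f0 - fs <= 2 * K / N%:R.
  pose a := (1 + s)^-1.
  have c0 : 0 < 1 + s by lra.
  have a01 : 0 <= a <= 1 by rewrite invr_ge0 (ltW c0)/= invf_le1//; lra.
  have := line a s (- 1) a01.
  rewrite (_ : a * s + (1 - a) * - 1 = 0); last by rewrite /a; field; rewrite gt_eqF.
  move=> h.
  have h1 : (1 + s) * f0 <= fs + s * phi (- 1).
    have -> : fs + s * phi (- 1) =
        (1 + s) * (a * fs + (1 - a) * phi (- 1)).
      by rewrite /a; field; rewrite gt_eqF.
    by rewrite ler_pM2l.
  have /andP[_ h2] : - K <= phi (- 1) <= K by apply: bd; rewrite normrN1.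
  have h3 : s * (phi (- 1) - f0) <= N%:R^-1 * (2 * K).
    apply: le_trans (_ : s * (2 * K) <= _); first by rewrite ler_pM2l//; lra.
    by rewrite ler_wpM2r ?(ltW sN) ?mulr_ge0.
  lra.
have hi : F - f0 <= 2 * K / N%:R.
  have := line N%:R^-1 1 0 _; rewrite mulr1 mulr0 addr0 -/F -/f0 => h.
  have {}h := h ltac:(by rewrite invr_ge0 (ltW NR) N1).
  have /andP[_ h2] : - K <= phi 1 <= K by apply: bd; rewrite normr1.
  have h3 : N%:R^-1 * (phi 1 - f0) <= N%:R^-1 * (2 * K).
    by rewrite ler_pM2l ?invr_gt0//; lra.
  lra.
have h4 : s * (N%:R * (F - f0)) <= 2 * K / N%:R.
  have sN0 : 0 <= s * N%:R by rewrite mulr_ge0 ?(ltW s0) ?(ltW NR).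
  have sN1 : s * N%:R <= 1 by rewrite -ler_pdivlMr// mul1r ltW.
  rewrite mulrA; apply: le_trans (_ : s * N%:R * (2 * K / N%:R) <= _).
    by rewrite ler_wpM2l.
  by rewrite ler_piMl// divr_ge0 ?mulr_ge0 ?(ltW NR).
lra.
Qed.

Section vanishing.
Context {dT : measure_display} {T : measurableType dT} {R : realType}.
Variable P : probability T R.

Lemma normr_expect_le (f : T -> R) c :
  bounded_meas f -> (forall w, `|f w| <= c) -> `|expect P f| <= c.
Proof.
move=> bf fc; rewrite ler_norml; apply/andP; split;
  [rewrite -[leLHS](expect_cst P (- c)) | rewrite -[leRHS](expect_cst P c)];
  apply: le_expect => //; try exact: bounded_meas_cst;
  by move=> w /=; have := fc w; rewrite ler_norml => /andP[].
Qed.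

Lemma bounded_meas_indic (A : set T) : measurable A -> bounded_meas (\1_A : T -> R).
Proof.
move=> mA; split; first exact: measurable_indic.
by exists 1 => w; rewrite indicE; case: (w \in A); rewrite ?normr1 ?normr0.
Qed.

(** A bounded function of [V] is uniformly close to one with finitely many values,
    for which the integral is a combination of vanishing ones. *)
Lemma expect_orthogonal {dE} {E : measurableType dE} (V : T -> E) (g : E -> R)
    (z : T -> R) (C : R) :
  measurable_fun setT V -> bounded_meas z -> measurable_fun setT g ->
  (forall w, `|g (V w)| <= C) ->
  (forall B, measurable B -> \int[P]_(w in V @^-1` B) z w = 0) ->
  expect P (fun w => z w * g (V w)) = 0.
Proof.
move=> mV bz mg gC z0; have [mz [D zD]] := bz.
have [w0|noT] := pselect (exists w : T, True); last first.
  rewrite -[RHS](expect_cst P 0); congr expect; apply/funext => w.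
  by exfalso; apply: noT; exists w.
have [w0' _] := w0.
have D0 : 0 <= D := le_trans (normr_ge0 _) (zD w0').
have C0 : 0 <= C := le_trans (normr_ge0 _) (gC w0').
have mgV : measurable_fun setT (g \o V) by exact: measurableT_comp.
have z1 (A : set E) : measurable A -> expect P (fun w => z w * \1_A (V w)) = 0.
  move=> mA; rewrite -(z0 _ mA) [RHS]Rintegral_mkcond; congr expect.
  apply/funext => w; rewrite patchE indicE.
  rewrite (_ : (w \in V @^-1` A) = (V w \in A)).
    by case: ifP; rewrite ?mulr1 ?mulr0.
  by apply/idP/idP; rewrite !inE.
have mV' (A : set E) : measurable A -> measurable (V @^-1` A).
  by move=> mA; have := mV measurableT A mA; rewrite setTI.
have b1 (A : set E) : measurable A -> bounded_meas (fun w => \1_A (V w) : R).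
  by move=> /mV' /bounded_meas_indic.
have ez : expect P z = 0.
  rewrite -[RHS](z1 setT)//; congr expect; apply/funext => w.
  by rewrite indicE in_setT mulr1.
have bg : bounded_meas (fun w => g (V w)) by split; [|exists C].
have eg : expect P (fun w => z w * g (V w)) = expect P (fun w => z w * (g (V w) + C)).
  under [in RHS]eq_fun do rewrite mulrDr [z _ * C]mulrC.
  by rewrite expectD ?expectZ ?ez ?mulr0 ?addr0//; [exact: bounded_measM | exact: bounded_measZ].
apply/eqP; rewrite -normr_le0; apply/ler_addgt0Pr => e e0; rewrite add0r.
have [N N0 NE] : exists2 N : nat, (0 < N)%N & D / N%:R <= e.
  exists (Num.truncn (D / e)).+1 => //; rewrite ler_pdivrMr ?ltr0n// [e * _]mulrC.
  by rewrite -ler_pdivrMr// ltW// truncnS_gt.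
have NR : 0 < N%:R :> R by rewrite ltr0n.
pose M := (Num.truncn (2 * C * N%:R)).+1.
pose A (m : 'I_M) := [set x : E | (m%:R <= (g x + C) * N%:R) && ((g x + C) * N%:R < m.+1%:R)].
have mA m : measurable (A m).
  have mb : measurable_fun setT (fun x : E => (m%:R <= (g x + C) * N%:R :> R) && ((g x + C) * N%:R < m.+1%:R :> R)).
    have mgC : measurable_fun setT (fun x => (g x + C) * N%:R).
      by apply: measurable_funM => //; exact: measurable_funD.
    apply: measurable_and; first exact: measurable_fun_ler.
    exact: measurable_fun_ltr.
  by have := mb measurableT [set true] I; rewrite setTI.
pose F w : R := \sum_(m < M) (m%:R / N%:R) * \1_(A m) (V w).
have bF : bounded_meas F.
  by apply: bounded_meas_sum => m; apply: bounded_measZ; exact: b1.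
have F0 : expect P (fun w => z w * F w) = 0.
  under [X in expect P X]eq_fun => w.
    rewrite /F mulr_sumr; under eq_bigr do rewrite mulrCA; over.
  rewrite expect_sum; last by move=> m; apply: bounded_measZ; apply: bounded_measM => //; exact: b1.
  rewrite big1// => m _; rewrite expectZ ?z1 ?mulr0//.
  by apply: bounded_measM => //; exact: b1.
have bgC : bounded_meas (fun w => g (V w) + C).
  exact: (bounded_measD bg (bounded_meas_cst C)).
rewrite eg -[X in `|X|]subr0 -F0 -expectB; try exact: bounded_measM.
under [X in expect P X]eq_fun do rewrite -mulrBr.
apply: le_trans NE; apply: normr_expect_le.
  by apply: bounded_measM => //; exact: bounded_measB.
move=> w; rewrite normrM ler_pM//.
have gw := gC w; rewrite ler_norml in gw; case/andP: gw => g1 g2.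
have gN0 : 0 <= (g (V w) + C) * N%:R by rewrite mulr_ge0//; lra.
have kM : (Num.truncn ((g (V w) + C) * N%:R) < M)%N.
  rewrite ltnS; apply: le_truncn; rewrite ler_wpM2r//; lra.
have kP := truncn_itv gN0.
have -> : F w = (Num.truncn ((g (V w) + C) * N%:R))%:R / N%:R.
  rewrite /F (bigD1 (Ordinal kM))//= indicE mem_set//= mulr1 big1 ?addr0// => m mk.
  rewrite indicE memNset ?mulr0// => /andP[h1 h2]; move/eqP: mk; apply.
  apply: val_inj => /=; apply/esym/eqP; rewrite truncn_eq//.
  by rewrite h1 h2.
case/andP: kP => k1 k2.
rewrite ger0_norm; last by rewrite subr_ge0 ler_pdivrMr.
set k := Num.truncn _ in k2 *.
rewrite lerBlDr (_ : _ + _ / _ = k.+1%:R / N%:R); last by rewrite -nat1r mulrDl mul1r.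
by rewrite ler_pdivlMr// ltW.
Qed.

(** Jensen's inequality given [V], for a perturbation whose conditional mean
    vanishes. The supporting slope at [g (V w)] is replaced by a difference
    quotient, which is measurable, at the cost of an error that tends to 0. *)
Lemma expect_vanishing_le {dE} {E : measurableType dE} q (V : T -> E)
    (g : E -> 'cV[R]_q) (z : T -> R) (v : 'cV[R]_q) (f : 'cV[R]_q -> R) :
  is_convex f -> measurable_fun setT V -> measurable_fun setT g ->
  bounded_vec (g \o V) -> bounded_meas z ->
  (forall B, measurable B -> \int[P]_(w in V @^-1` B) z w = 0) ->
  expect P (fun w => f (g (V w))) <= expect P (fun w => f (g (V w) + z w *: v)).
Proof.
move=> cf mV mg [mgV [C gC]] bz z0; have [mz [D zD]] := bz.
have [K HK] := convex_locally_bounded cf (C + (1 + `|D|) * `|v|).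
have Kb y s : `|y| <= C -> `|s| <= 1 + `|D| -> `|f (y + s *: v)| <= K.
  move=> yC sD; apply: HK; apply: le_trans (ler_normD _ _) _.
  by rewrite lerD// normrZ ler_wpM2r.
have bfg : bounded_meas (fun w => f (g (V w))).
  by apply: convex_bounded_meas => //; split => //; exists C.
have bfz : bounded_meas (fun w => f (g (V w) + z w *: v)).
  apply: convex_bounded_meas => //; apply: bounded_vecD; first by split => //; exists C.
  by apply/bounded_vecP => i j; under eq_fun do rewrite mxE mulrC; exact: bounded_measZ.
apply/ler_addgt0Pr => e e0.
have [w0|noT] := pselect (exists w : T, True); last first.
  apply: le_trans (_ : _ <= expect P (fun w => f (g (V w) + z w *: v)) ) _.
    by apply: le_expect => // w; exfalso; apply: noT; exists w.
  by rewrite lerDl ltW.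
have [w1 _] := w0.
have D0 : `|D| = D by rewrite ger0_norm// (le_trans _ (zD w1)).
have C0 : 0 <= C by rewrite (le_trans _ (gC w1)).
have K0 : 0 <= K.
  by apply: le_trans (Kb 0 0 _ _); rewrite ?normr0 // addr_ge0.
have [N N0 NE] : exists2 N : nat, (0 < N)%N & 4 * K / N%:R <= e.
  exists (Num.truncn (4 * K / e)).+1 => //; rewrite ler_pdivrMr ?ltr0n// [e * _]mulrC.
  by rewrite -ler_pdivrMr// ltW// truncnS_gt.
have NR : 0 < N%:R :> R by rewrite ltr0n.
have N1 : N%:R^-1 <= 1 :> R by rewrite invf_le1// ler1n.
pose p y : R := N%:R * (f (y + N%:R^-1 *: v) - f y).
have slope y s : `|y| <= C -> `|s| <= 1 + `|D| ->
    f y + s * p y - 4 * K / N%:R <= f (y + s *: v).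
  move=> yC sD.
  rewrite /p; have y0 : f y = f (y + 0 *: v) by rewrite scale0r addr0.
  rewrite y0; apply: (difference_quotient_le (phi := fun t => f (y + t *: v))) => //.
    by move=> a s1 s2 a01; exact: is_convex_line.
  by move=> t t1; apply: Kb => //; rewrite (le_trans t1)// lerDl.
have mf := convex_measurable cf.
have mp : measurable_fun setT (p \o g).
  apply: measurableT_comp mg; apply: measurable_funM => //.
  apply: measurable_funB => //; apply: convex_measurable.
  apply: (is_convex_affine cf) => a x y.
  by rewrite !scalerDr addrACA -scalerDl subrKC scale1r.
have pC w : `|p (g (V w))| <= N%:R * (2 * K).
  rewrite /p normrM gtr0_norm// ler_pM2l//.
  apply: le_trans (ler_normB _ _) _; rewrite mulr2n mulrDl mul1r lerD//.
    by apply: Kb; rewrite ?gC// [X in X <= _]gtr0_norm ?invr_gt0//; have := normr_ge0 D; lra.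
  have := Kb (g (V w)) 0 (gC w); rewrite scale0r addr0 normr0; apply.
  by rewrite addr_ge0.
have o := expect_orthogonal mV bz mp pC z0.
have bp : bounded_meas (fun w => p (g (V w))).
  by split; [exact: measurableT_comp mp mV | eexists; exact: pC].
have bzp : bounded_meas (fun w => z w * p (g (V w))) by exact: bounded_measM.
have : expect P (fun w => (f (g (V w)) + z w * p (g (V w))) - 4 * K / N%:R) <=
    expect P (fun w => f (g (V w) + z w *: v)).
  apply: le_expect => //.
    apply: bounded_measB; [exact: bounded_measD | exact: bounded_meas_cst].
  by move=> w; apply: slope; [exact: gC | apply: le_trans (zD w) _; rewrite D0; lra].
rewrite expectB ?expectD//; last exact: bounded_meas_cst; last exact: bounded_measD.
have -> : expect P (fun w => z w * p (g (V w))) = 0 := o.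
rewrite [X in _ - X](expect_cst P (4 * K / N%:R)); lra.
Qed.

End vanishing.

(** * Noises for diagonal coefficients *)

Section diagonal_noise.
Context {dT : measure_display} {T : measurableType dT} {R : realType}.
Variables (P : probability T R) (q : nat).
Implicit Types (Z : T -> 'cV[R]_q) (f : 'cV[R]_q -> R) (a b : 'rV[R]_q).

Definition insert_coord (i : 'I_q) (vs : 'cV[R]_q.-1 * R) : 'cV[R]_q :=
  \col_j (if unlift i j is Some j' then vs.1 j' 0 else vs.2).

Lemma insert_coordE Z i w : insert_coord i (others Z i w, Defs.coord Z i w) = Z w.
Proof.
apply/colP => j; rewrite mxE; case: unliftP => [k ->|->] //=.
by rewrite mxE.
Qed.

Lemma measurable_insert_coord i : measurable_fun setT (insert_coord i).
Proof.
apply: measurable_mx => j k; under eq_fun do rewrite mxE.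
case: (unlift i j) => [j'|]; last exact: measurable_snd.
exact: measurableT_comp (measurable_entry j' 0) measurable_fst.
Qed.

Lemma measurable_others Z i : measurable_fun setT Z -> measurable_fun setT (others Z i).
Proof.
move=> /measurable_mxP mZ; apply: measurable_mx => j k.
by under eq_fun do rewrite mxE; exact: mZ.
Qed.

(** With coordinate [i] of the weight set to [0] the value is smallest, by Jensen's
    inequality given the other coordinates, and [a] lies between this weight and
    [b]. *)
Lemma vanishing_step Z : bounded_vec Z -> vanishing_cond_exp P Z ->
  forall f, is_convex f -> forall a b i, (forall j, j != i -> a 0 j = b 0 j) ->
  (exists2 s : R, 0 <= s <= 1 & a 0 i = s * b 0 i) ->
  expect P (fun w => f (diag_mx a *m Z w)) <= expect P (fun w => f (diag_mx b *m Z w)).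
Proof.
move=> bZ vZ f cf a b i ab [s s01 aib].
pose b0 : 'rV[R]_q := \row_j (if j == i then 0 else b 0 j).
have ch := is_convex_diag P cf bZ.
have -> : a = s *: b + (1 - s) *: b0.
  apply/rowP => j; rewrite !mxE; case: eqP => [->|/eqP ji].
    by rewrite aib mulr0 addr0.
  by rewrite ab// -mulrDl addrC subrK mul1r.
apply: le_trans (ch _ _ _ s01) _.
suff le0 : expect P (fun w => f (diag_mx b0 *m Z w)) <=
    expect P (fun w => f (diag_mx b *m Z w)).
  case/andP: s01 => s0 s1; have s1' : 0 <= 1 - s by rewrite subr_ge0.
  by have := ler_wpM2l s1' le0; lra.
have [mZ _] := bZ.
have bz : bounded_meas (Defs.coord Z i) by move/bounded_vecP: bZ; exact.
pose V := others Z i.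
pose g (v : 'cV[R]_q.-1) : 'cV[R]_q := diag_mx b0 *m insert_coord i (v, 0).
have gV w : g (V w) = diag_mx b0 *m Z w.
  rewrite /g !mul_diag_mx; apply/colP => j; rewrite !mxE.
  case: unliftP => [k ->|->]; first by rewrite mxE.
  by rewrite eqxx !mul0r.
have mg : measurable_fun setT g.
  apply: measurable_mx => j k; rewrite /g.
  under eq_fun do rewrite mul_diag_mx mxE.
  apply: measurable_funM => //.
  apply: measurableT_comp (measurable_entry j k) _.
  apply: measurableT_comp (measurable_insert_coord i) _.
  exact: pair2_measurable.
have bgV : bounded_vec (g \o V).
  have -> : g \o V = (fun w => diag_mx b0 *m Z w) by apply/funext => w; rewrite /= gV.
  exact: bounded_vec_mul.
have z0 (B : set 'cV[R]_q.-1) : measurable B -> \int[P]_(w in V @^-1` B) Defs.coord Z i w = 0.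
  move=> mB; have [_ _ _ vI] := vZ i.
  rewrite /Rintegral -(vI (V @^-1` B)); last by exists B => //; rewrite setTI.
  by rewrite integral0.
have := @expect_vanishing_le _ _ _ P _ _ _ V g (Defs.coord Z i) (b 0 i *: delta_mx i 0) f cf
  (measurable_others i mZ) mg bgV bz z0.
have -> : (fun w => f (g (V w))) = (fun w => f (diag_mx b0 *m Z w)).
  by apply/funext => w; rewrite gV.
congr (_ <= expect P _); apply/funext => w; congr f; rewrite gV !mul_diag_mx.
apply/colP => j; rewrite !mxE; case: eqP => [->|_].
  by rewrite mul0r add0r mulr1 mulrC /Defs.coord.
by rewrite /= mulr0 mulr0 addr0.
Qed.

Lemma vanishing_transport Z (th : 'cV[R]_q -> 'M[R]_q) :
  bounded_vec Z -> vanishing_cond_exp P Z -> diag_nonneg_convex th ->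
  convex_transport P Z th.
Proof.
move=> bZ vZ [dth cth].
have rr (s t : R) : 0 <= s -> s <= t -> exists2 c : R, 0 <= c <= 1 & s = c * t.
  move=> s0 st; have [t0|t0] := eqVneq t 0.
    by exists 0; rewrite ?lexx ?ler01// mul0r; lra.
  have tp : 0 < t by rewrite lt_def t0 (le_trans s0).
  by exists (s / t); rewrite ?divfK// divr_ge0 ?(ltW tp)//= ler_pdivrMr// mul1r.
apply: (diag_transport (u := fun x => \row_i th x i i)
  (r := fun s t => exists2 c : R, 0 <= c <= 1 & s = c * t) bZ dth (vanishing_step bZ vZ)).
  by move=> x i; rewrite mxE; have [th0 _] := cth i i erefl; split; apply: (rr _ _ (th0 x)).
move=> x y a i a01; have [th0 /convex_functionP cthi] := cth i i erefl.
by rewrite !mxE; apply: rr => //; exact: cthi.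
Qed.

(** Rectangles are stable under intersection and generate the product
    sigma-algebra. *)
Lemma pair_law {d1 d2} {E1 : measurableType d1} {E2 : measurableType d2}
    (X Y : T -> E1 * E2) :
  measurable_fun setT X -> measurable_fun setT Y ->
  (forall A B, measurable A -> measurable B ->
    P (X @^-1` (A `*` B)) = P (Y @^-1` (A `*` B))) ->
  forall C, measurable C -> P (X @^-1` C) = P (Y @^-1` C).
Proof.
move=> mX mY XY C mC.
pose X' : {mfun T >-> (E1 * E2)%type} := mfun_Sub (mem_set mX).
pose Y' : {mfun T >-> (E1 * E2)%type} := mfun_Sub (mem_set mY).
pose G := [set A `*` B | A in @measurable _ E1 & B in @measurable _ E2].
have GE : [set Q | G Q /\ Q `<=` setT] = G by apply/seteqP; split=> [Q []|Q].
have H := @g_sigma_algebra_measure_unique_trace _ R (E1 * E2)%type G setT measurableT.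
rewrite GE in H; rewrite -[LHS]/(distribution P X' C) -[RHS]/(distribution P Y' C).
apply: H => //.
- by move=> _ [A mA [B mB <-]]; exact: measurableX.
- move=> _ _ [A1 mA1 [B1 mB1 <-]] [A2 mA2 [B2 mB2 <-]]; rewrite -setXI.
  by exists (A1 `&` A2); [exact: measurableI | exists (B1 `&` B2) => //; exact: measurableI].
- by move=> _ [A mA [B mB <-]]; exact: XY.
- by apply: le_lt_trans (probability_le1 _ _) _; rewrite ?ltry.
- by rewrite -measurable_prod_measurableType.
Qed.

(** Equality of the conditional laws of [Z_i] and [- Z_i] amounts to invariance of
    the joint law under the change of sign of coordinate [i]. *)
Lemma symmetric_flip_law Z i : measurable_fun setT Z -> symmetric_cond_laws P Z ->
  forall B : set 'cV[R]_q, measurable B ->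
  P ((fun w => insert_coord i (others Z i w, - Defs.coord Z i w)) @^-1` B) = P (Z @^-1` B).
Proof.
move=> mZ sZ B mB.
have mo := measurable_others i mZ.
have mc : measurable_fun setT (Defs.coord Z i) by move/measurable_mxP: mZ; exact.
have mp := measurable_fun_pair mo mc.
have mn := measurable_fun_pair mo (measurableT_comp (@oppr_measurable _ setT) mc).
have mI : measurable (insert_coord i @^-1` B).
  by have := measurable_insert_coord i measurableT mB; rewrite setTI.
have -> : Z @^-1` B = (fun w => (others Z i w, Defs.coord Z i w)) @^-1` (insert_coord i @^-1` B).
  by apply/seteqP; split=> w; rewrite /preimage /= insert_coordE.
apply: (pair_law mn mp) => // A C mA mC.
have [K [K' [KZ KN KK]]] := sZ i.
have h1 := KZ A C mA mC; have h2 := KN A C mA mC.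
transitivity (P (others Z i @^-1` A `&` (fun w => - Defs.coord Z i w) @^-1` C)) => //.
transitivity (P (others Z i @^-1` A `&` Defs.coord Z i @^-1` C)) => //.
rewrite h1 h2; apply: ae_eq_integral.
- by have := mo measurableT A mA; rewrite setTI.
- apply: measurable_funTS; exact: (measurableT_comp (measurable_kernel K' C mC) mo).
- apply: measurable_funTS; exact: (measurableT_comp (measurable_kernel K C mC) mo).
- by case: KK => N [mN N0 KN']; exists N; split => // w /= h; apply: KN' => /= KKw; apply: h => _; rewrite KKw.
Qed.

(** [a] lies between [b] and [b] with the sign of coordinate [i] changed, which
    give the same value. *)
Lemma symmetric_step Z : bounded_vec Z -> symmetric_cond_laws P Z ->
  forall f, is_convex f -> forall a b i, (forall j, j != i -> a 0 j = b 0 j) ->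
  (exists2 s : R, `|s| <= 1 & a 0 i = s * b 0 i) ->
  expect P (fun w => f (diag_mx a *m Z w)) <= expect P (fun w => f (diag_mx b *m Z w)).
Proof.
move=> bZ sZ f cf a b i ab [s s1 aib].
move: s1; rewrite ler_norml => /andP[s0 s1].
pose b' : 'rV[R]_q := \row_j (if j == i then - b 0 j else b 0 j).
have ch := is_convex_diag P cf bZ.
pose c := (1 + s) / 2.
have c01 : 0 <= c <= 1 by rewrite /c; lra.
have -> : a = c *: b + (1 - c) *: b'.
  apply/rowP => j; rewrite !mxE; case: eqP => [->|/eqP ji].
    by rewrite aib /c; field.
  by rewrite ab// -mulrDl addrC subrK mul1r.
apply: le_trans (ch _ _ _ c01) _.
suff -> : expect P (fun w => f (diag_mx b' *m Z w)) =
    expect P (fun w => f (diag_mx b *m Z w)).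
  by rewrite -mulrDl addrC subrK mul1r.
pose N w := insert_coord i (others Z i w, - Defs.coord Z i w).
have [mZ _] := bZ.
have bN : bounded_vec N.
  apply/bounded_vecP => j k; rewrite /N.
  under eq_fun do rewrite mxE.
  move/bounded_vecP: bZ => bZ.
  case: (unlift i j) => [j'|] /=.
    by under eq_fun do rewrite mxE; exact: bZ.
  have := bounded_measZ (-1) (bZ i 0).
  by under eq_fun do rewrite mulN1r.
have cb : is_convex (fun z : 'cV[R]_q => f (diag_mx b *m z)).
  by apply: (is_convex_affine cf) => x y t; rewrite mulmxDr -!scalemxAr.
have [_ [C1 h1]] := convex_bounded_meas cb bZ.
have [_ [C2 h2]] := convex_bounded_meas cb bN.
rewrite -[RHS]/(expect P ((fun z => f (diag_mx b *m z)) \o Z)).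
rewrite -(@expect_eq_law _ _ _ P _ _ N Z _ (Num.max C1 C2)).
- congr expect; apply/funext => w /=; congr f; rewrite !mul_diag_mx.
  apply/colP => j; rewrite !mxE; case: unliftP => [k ->|->] /=.
    by rewrite eq_sym (negbTE (neq_lift _ _)) mxE.
  by rewrite eqxx mulNr mulrN.
- by case: bN.
- by [].
- by move=> B mB; exact: symmetric_flip_law.
- exact: convex_measurable.
- by move=> w; rewrite le_max h2 orbT.
- by move=> w; rewrite le_max h1.
Qed.

Lemma symmetric_transport Z (th : 'cV[R]_q -> 'M[R]_q) :
  bounded_vec Z -> symmetric_cond_laws P Z -> diag_abs_convex th ->
  convex_transport P Z th.
Proof.
move=> bZ sZ [dth cth].
have rr (s t : R) : `|s| <= t -> exists2 c : R, `|c| <= 1 & s = c * t.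
  move=> st; have t0 := le_trans (normr_ge0 s) st; have [tz|tn] := eqVneq t 0.
    exists 0; rewrite ?normr0 ?ler01// mul0r.
    by apply/eqP; rewrite -normr_le0 -tz.
  have tp : 0 < t by rewrite lt_def tn.
  exists (s / t); rewrite ?divfK//.
  by rewrite normrM [ `|t^-1|]gtr0_norm ?invr_gt0// ler_pdivrMr// mul1r.
apply: (diag_transport (u := fun x => \row_i `|th x i i|)
  (r := fun s t => exists2 c : R, `|c| <= 1 & s = c * t) bZ dth (symmetric_step bZ sZ)).
  move=> x i; rewrite mxE; split; first by apply: rr.
  exists (Num.sg (th x i i)); last by rewrite -normrEsg.
  by rewrite normr_sg lern1 leq_b1.
move=> x y a i a01; have /convex_functionP cthi := cth i i erefl.
by rewrite !mxE; apply: rr => //; exact: cthi.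
Qed.

End diagonal_noise.

(** * One Euler step preserves convexity *)

Section euler_step.
Context {dT : measure_display} {T : measurableType dT} {R : realType}.
Variable P : probability T R.
Variables (d n : nat).
Implicit Types (M : 'M[R]_(d, n)) (v : 'cV[R]_d).

Definition set_col (k : 'I_n) M v : 'M[R]_(d, n) :=
  \matrix_(i, j) (if j == k then v i 0 else M i j).

Lemma set_col_conv k (a : R) M N u v :
  set_col k (a *: M + (1 - a) *: N) (a *: u + (1 - a) *: v) =
  a *: set_col k M u + (1 - a) *: set_col k N v.
Proof. by apply/matrixP => i j; rewrite !mxE; case: ifP. Qed.

Lemma col_set_col k M v : col k (set_col k M v) = v.
Proof. by apply/colP => i; rewrite !mxE eqxx. Qed.

Lemma set_col_set_col k M u v : set_col k (set_col k M u) v = set_col k M v.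
Proof. by apply/matrixP => i j; rewrite !mxE; case: (j == k). Qed.

Lemma set_col_col k M : set_col k M (col k M) = M.
Proof. by apply/matrixP => i j; rewrite !mxE; case: eqP => // ->. Qed.

Lemma bounded_set_col k (M : T -> 'M[R]_(d, n)) (v : T -> 'cV[R]_d) :
  bounded_vec M -> bounded_vec v -> bounded_vec (fun w => set_col k (M w) (v w)).
Proof.
move=> /bounded_vecP bM /bounded_vecP bv; apply/bounded_vecP => i j.
by under eq_fun do rewrite mxE; case: (j == k); [exact: bv | exact: bM].
Qed.

Lemma is_convex_set_col k (f : 'M[R]_(d, n) -> R) M : is_convex f ->
  is_convex (fun v => f (set_col k M v)).
Proof.
move=> cf; apply: (is_convex_affine cf) => a u v.
by rewrite -set_col_conv -scalerDl subrKC scale1r.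
Qed.

(** A path is a matrix of fixed size and a step overwrites a column, so that the
    value functions at all times are functions on the same space. *)
Definition euler_value q (k l : 'I_n) (th : 'cV[R]_d -> 'M[R]_(d, q))
    (Z : T -> 'cV[R]_q) (f : 'M[R]_(d, n) -> R) M : R :=
  expect P (fun w => f (set_col l M (col k M + th (col k M) *m Z w))).

(** At a barycentre of two paths the coefficient is replaced by the barycentre of
    [Bx] and [By], which makes the argument of [f] a barycentre. *)
Lemma euler_value_convex q (k l : 'I_n) (th : 'cV[R]_d -> 'M[R]_(d, q))
    (Z : T -> 'cV[R]_q) (f : 'M[R]_(d, n) -> R) :
  bounded_vec Z -> convex_transport P Z th -> is_convex f ->
  is_convex (euler_value k l th Z f).
Proof.
move=> bZ tr cf a x y a01.
have [Bx [By [ex ey le]]] := tr (col k x) (col k y) a a01.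
have cfs M : is_convex (fun v => f (set_col l M (col k M + v))).
  apply: (is_convex_affine (is_convex_set_col l M cf)) => b u v.
  by rewrite !scalerDr addrACA -scalerDl subrKC scale1r.
have bf M (B : 'M[R]_(d, q)) : bounded_meas (fun w => f (set_col l M (col k M + B *m Z w))).
  exact: (convex_bounded_meas (cfs M) (bounded_vec_mul B bZ)).
have colE : col k (a *: x + (1 - a) *: y) = a *: col k x + (1 - a) *: col k y.
  by apply/colP => i; rewrite !mxE.
rewrite /euler_value -(ex _ (cfs x)) -(ey _ (cfs y)).
have := le _ (cfs (a *: x + (1 - a) *: y)); rewrite colE => le1.
apply: le_trans le1 _.
rewrite -!expectZ// -expectD; try exact: bounded_measZ.
apply: le_expect => [||w].
- by have := bf (a *: x + (1 - a) *: y) (a *: Bx + (1 - a) *: By); rewrite colE.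
- by apply: bounded_measD; exact: bounded_measZ.
apply: le_trans _ (cf _ _ _ a01).
by rewrite -set_col_conv mulmxDl -!scalemxAl !scalerDr addrACA.
Qed.

End euler_step.

(** * Locally bounded coefficients *)

Section locally_bounded.
Context {R : realType} {d m p : nat}.

(** By compactness of the product of segments containing the ball, transported to
    column vectors by transposition. *)
Lemma locally_bounded_ball (f : 'cV[R]_d -> 'M[R]_(m, p)) :
  [locally [bounded f x | x in [set: 'cV[R]_d]]] ->
  forall r, exists C, forall x, `|x| <= r -> `|f x| <= C.
Proof.
move=> lf r.
pose K := [set v : 'rV[R]_d | forall i, v ord0 i \in `[(- r), r]].
have cK : compact K.
  apply: (@rV_compact _  _ (fun=> `[(- r), r]%classic)) => _.
  exact: segment_compact.
have /compact_near_coveringP nK := cK.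
have trc : continuous (fun v : 'rV[R]_d => v^T).
  move=> v; apply/(@cvgrPdist_lt _ _ _ _ (nbhs_filter v)) => e e0.
  apply/nbhs_ballP; exists e => // u; rewrite mx_norm_ball /ball_ /= => vu.
  rewrite -linearB; apply: le_lt_trans vu; apply: mx_norm_le => // i j.
  by rewrite mxE; exact: mx_norm_entry.
have := nK R +oo (fun M v => `|f v^T| <= M) _ _.
case.
  move=> v Kv; have [M0 [M0r h]] := lf v^T I.
  have {}h := h (M0 + 1) ltac:(by rewrite ltrDl).
  exists ([set u : 'rV[R]_d | `|f u^T| <= M0 + 1], [set M : R | M0 + 1 < M]) => /=.
    split.
      have h' : nbhs v [set u | [set: 'cV[R]_d] u^T -> `|f u^T| <= M0 + 1] := trc v _ h.
      by apply: filterS h' => u /= hu; exact: hu.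
    by exists (M0 + 1); rewrite num_real.
  by move=> [u M] /= [h1 h2]; apply: le_trans h1 (ltW h2).
move=> M [_ HM]; exists (M + 1) => x xr.
have := HM (M + 1); rewrite ltrDl ltr01 => /(_ isT) /(_ x^T); rewrite trmxK; apply.
move=> i; rewrite mxE in_itv /= -ler_norml; apply: le_trans xr; exact: mx_norm_entry.
Qed.

End locally_bounded.

(** * Barycentric coordinates *)

Section barycentric.
Context {R : realType} {d : nat}.
Variables (t : dual_scheme R d) (G : set 'cV[R]_d).
Hypothesis tG : delaunay t G.
Local Notation N := (ds_size t).
Local Notation p := (@ds_point R d t).

Definition bary_system (k : 'I_(ds_num t)) (xi : 'cV[R]_d) (l : 'I_N -> R) :=
  [/\ forall i, i \notin ds_simplex k -> l i = 0, \sum_i l i = 1 &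
      \sum_i l i *: p i = xi].

Lemma sum_simplex k (W : zmodType) (F : 'I_N -> W) :
  (forall i, i \notin ds_simplex k -> F i = 0) ->
  \sum_(i in @ds_simplex R d t k) F i = \sum_i F i.
Proof.
move=> F0; rewrite [RHS](bigID (mem (ds_simplex k)))/=.
by rewrite [X in _ + X]big1 ?addr0// => j /F0.
Qed.

Lemma bary_system_unique k xi l l' :
  bary_system k xi l -> bary_system k xi l' -> l =1 l'.
Proof.
case: tG => _ [_ aff _ _ _] _ _ [l0 l1 lx] [l0' l1' lx'] i.
have [iS|iS] := boolP (i \in ds_simplex k); last by rewrite l0// l0'.
apply/eqP; rewrite -subr_eq0; apply/eqP.
apply: (aff k (fun j => l j - l' j)) iS.
- rewrite sum_simplex; last by move=> j jS; rewrite l0// l0'// subrr.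
  by rewrite sumrB l1 l1' subrr.
- rewrite sum_simplex; last by move=> j jS; rewrite l0// l0'// subrr scale0r.
  by under eq_bigr do rewrite scalerBl; rewrite sumrB lx lx' subrr.
Qed.

(** A point of the hull is given with an arbitrary family of vertices; the weights
    of a repeated vertex are summed. *)
Lemma baryP k xi : conv_hull (vertices k) xi ->
  bary_system k xi (bary k xi) /\ forall i, 0 <= bary k xi i.
Proof.
move=> [m [x [w [xv w0 w1 xiE]]]].
have /choice[c cP] : forall j, exists i, i \in ds_simplex k /\ p i = x j.
  by move=> j; have [i iS ix] := xv j; exists i.
pose l : {ffun 'I_N -> R} := [ffun i => \sum_(j | c j == i) w j].
have lS : bary_system k xi l.
  split.
  - move=> i iS; rewrite ffunE big1// => j /eqP ji.
    by move: iS; rewrite -ji (cP j).1.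
  - rewrite -w1 (partition_big c xpredT)//=.
    by apply: eq_bigr => i _; rewrite ffunE.
  - rewrite xiE (partition_big c xpredT)//=.
    apply: eq_bigr => i _; rewrite ffunE scaler_suml.
    by apply: eq_bigr => j /eqP <-; rewrite (cP j).2.
have bS : bary_system k xi (bary k xi).
  rewrite /bary; case: xgetP => [l' -> //|nl]; exfalso; exact: (nl l lS).
split=> // i; rewrite (bary_system_unique bS lS) ffunE.
by apply: sumr_ge0.
Qed.

(** On a simplex the barycentric coordinates solve a linear system with
    independent rows, so that they are affine functions of the point. *)
Lemma bary_measurable k : exists l : 'I_N -> 'cV[R]_d -> R,
  (forall i, measurable_fun setT (l i)) /\
  forall xi, conv_hull (vertices k) xi -> forall i, bary k xi i = l i xi.
Proof.
pose X : 'M[R]_(N, d) := \matrix_(i, r) p i r 0.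
(* the last block forces the coordinates off the simplex to vanish *)
pose D : 'M[R]_N := diag_mx (\row_i (i \notin ds_simplex k)%:R).
pose M : 'M[R]_(N, d + 1 + N) := row_mx (row_mx X (const_mx 1)) D.
pose rhs (xi : 'cV[R]_d) : 'rV[R]_(d + 1 + N) := row_mx (row_mx xi^T (const_mx 1)) 0.
have mulM (l : 'rV[R]_N) : l *m M =
    row_mx (row_mx (\sum_i l 0 i *: p i)^T (const_mx (\sum_i l 0 i)))
      (\row_i (l 0 i * (i \notin ds_simplex k)%:R)).
  rewrite /M !mul_mx_row; congr (row_mx (row_mx _ _) _).
  - apply/rowP => r; rewrite !mxE summxE; apply: eq_bigr => i _.
    by rewrite !mxE.
  - by apply/rowP => r; rewrite !mxE; apply: eq_bigr => i _; rewrite mxE mulr1.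
  - by apply/rowP => r; rewrite mul_mx_diag !mxE.
have freeM : row_free M.
  rewrite -kermx_eq0; apply/eqP/row_matrixP => i0; rewrite row0.
  set l := row i0 (kermx M).
  have /eqP : l *m M = 0 by rewrite -row_mul mulmx_ker row0.
  rewrite mulM !row_mx_eq0 => /andP[/andP[/eqP h1 /eqP h2] /eqP h3].
  have l0 i : i \notin ds_simplex k -> l 0 i = 0.
    by move=> iS; have /rowP/(_ i) := h3; rewrite !mxE iS mulr1.
  apply/rowP => i; rewrite [RHS]mxE.
  have [iS|] := boolP (i \in ds_simplex k); last exact: l0.
  case: tG => _ [_ aff _ _ _] _ _; apply: (aff k (fun i => l 0 i)) iS.
    by rewrite sum_simplex//; have /rowP/(_ 0) := h2; rewrite !mxE.
  rewrite sum_simplex => [|j /l0 ->]; last by rewrite scale0r.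
  by apply: trmx_inj; rewrite h1 trmx0.
exists (fun i xi => (rhs xi *m pinvmx M) 0 i); split=> [i|xi xik i].
  have -> : (fun xi => (rhs xi *m pinvmx M) 0 i) =
      (fun xi => \sum_j rhs xi 0 j * pinvmx M j i).
    by apply/funext => xi; rewrite mxE.
  apply: measurable_sum => j; apply: measurable_funM => //.
  rewrite /rhs -[j]fintype.splitK; case: (fintype.split j) => j' /=.
    under eq_fun do rewrite row_mxEl.
    rewrite -[j']fintype.splitK; case: (fintype.split j') => j'' /=.
      by under eq_fun do rewrite row_mxEl mxE; exact: measurable_entry.
    by under eq_fun do rewrite row_mxEr mxE; exact: measurable_cst.
  by under eq_fun do rewrite row_mxEr mxE; exact: measurable_cst.
have [bS _] := baryP xik.
have : (\row_i bary k xi i) *m M = rhs xi.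
  rewrite mulM; case: bS => b0 b1 bx; rewrite /rhs; congr (row_mx (row_mx _^T _) _).
  - by rewrite -[RHS]bx; apply: eq_bigr => j _; rewrite mxE.
  - by congr const_mx; rewrite -[RHS]b1; apply: eq_bigr => j _; rewrite mxE.
  - apply/rowP => j; rewrite !mxE; have [jS|jS] := boolP (j \in ds_simplex k).
      by rewrite mulr0.
    by rewrite b0// mul0r.
by move=> <-; rewrite -mulmxA mulmxVp// mulmx1 mxE.
Qed.

End barycentric.

(** * The dual projection *)

Section dual_projection.
Context {R : realType} {d : nat}.
Variables (t : dual_scheme R d) (G : set 'cV[R]_d).
Hypothesis tG : delaunay t G.
Local Notation N := (ds_size t).
Local Notation p := (@ds_point R d t).

Definition cum_bary (k : 'I_(ds_num t)) (xi : 'cV[R]_d) (m : nat) : R :=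
  \sum_(j < N | (j < m)%N) bary k xi j.

Definition selects (k : 'I_(ds_num t)) (xi : 'cV[R]_d) (i : 'I_N) (u : R) : bool :=
  cum_bary k xi i <= u < cum_bary k xi i.+1.

Lemma conv_hull_cell xi : conv_hull G xi ->
  exists2 k, ds_cell k xi & conv_hull (@vertices R d t k) xi.
Proof.
case: tG => _ _ _ [_ _ <- sub] [k _ ck]; exists k => //; exact: sub.
Qed.

Lemma proj_del_cell k xi u : ds_cell k xi ->
  proj_del t xi u = \sum_(i < N | selects k xi i u) p i.
Proof.
case: tG => _ _ _ [_ triv _ _] ck; rewrite /proj_del (bigD1 k)//=.
rewrite indicE mem_set// scale1r [X in _ + X]big1 ?addr0// => l lk.
rewrite indicE memNset ?scale0r// => cl.
by move/trivIsetP: triv => /(_ l k I I lk) e; have : set0 xi by rewrite -e.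
Qed.

Section selection.
Variables (k : 'I_(ds_num t)) (xi : 'cV[R]_d).
Hypothesis kxi : conv_hull (vertices k) xi.

Let b0 i : 0 <= bary k xi i.
Proof. by have [_] := baryP tG kxi. Qed.

Lemma cum_bary0 : cum_bary k xi 0 = 0.
Proof. by rewrite /cum_bary big_pred0. Qed.

Lemma cum_bary_size : cum_bary k xi N = 1.
Proof.
have [[_ <- _] _] := baryP tG kxi.
by apply: eq_bigl => j; rewrite ltn_ord.
Qed.

Lemma cum_baryS (i : 'I_N) : cum_bary k xi i.+1 = cum_bary k xi i + bary k xi i.
Proof.
rewrite /cum_bary (bigD1 i)//= addrC; congr (_ + _); apply: eq_bigl => j.
by rewrite ltnS andbC -val_eqE -ltn_neqAle.
Qed.

Lemma le_cum_bary m m' : (m <= m')%N -> cum_bary k xi m <= cum_bary k xi m'.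
Proof.
move=> mm'; rewrite /cum_bary big_mkcond [leRHS]big_mkcond/=.
apply: ler_sum => j _; case: ifPn => [jm|_]; last by case: ifP.
by rewrite (leq_trans jm mm').
Qed.

Lemma selects_unique i j u : selects k xi i u -> selects k xi j u -> i = j.
Proof.
have H (i' j' : 'I_N) : selects k xi i' u -> selects k xi j' u -> (i' <= j')%N.
  move=> /andP[iu _] /andP[_ uj]; rewrite leqNgt; apply/negP => ji.
  by have := lt_le_trans uj (le_trans (le_cum_bary ji) iu); rewrite ltxx.
move=> si sj; apply: val_inj; apply/eqP.
by rewrite eqn_leq (H _ _ si sj) (H _ _ sj si).
Qed.

Lemma selects_ex u : 0 <= u < 1 -> exists i, selects k xi i u.
Proof.
move=> /andP[u0 u1].
have exm : exists m, (u < cum_bary k xi m) by exists N; rewrite cum_bary_size.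
case: (ex_minnP exm) => -[|m] um min.
  by move: um; rewrite cum_bary0 ltNge u0.
have mN : (m < N)%N by apply: min; rewrite cum_bary_size.
exists (Ordinal mN); rewrite /selects um andbT leNgt; apply/negP => h.
by have := min _ h; rewrite ltnn.
Qed.

Lemma sum_selects (W : lmodType R) (F : 'I_N -> W) i u : selects k xi i u ->
  \sum_j (selects k xi j u)%:R *: F j = F i.
Proof.
move=> si; rewrite (bigD1 i)//= si scale1r big1 ?addr0// => j ji.
case: (boolP (selects k xi j u)) => sj; last by rewrite scale0r.
by move: ji; rewrite (selects_unique sj si) eqxx.
Qed.

End selection.

Lemma proj_del_selects k xi i u : ds_cell k xi -> selects k xi i u ->
  proj_del t xi u = p i.
Proof.
move=> ck si; rewrite (proj_del_cell _ ck).
have kxi : conv_hull (vertices k) xi by case: tG => _ _ _ [_ _ _]; exact.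
rewrite -[RHS](sum_selects kxi p si) big_mkcond /=.
by apply: eq_bigr => j _; case: ifP; rewrite ?scale1r ?scale0r.
Qed.

Lemma proj_del_grid xi u : conv_hull G xi -> 0 <= u < 1 -> G (proj_del t xi u).
Proof.
move=> /conv_hull_cell[k ck kxi] u01; have [i si] := selects_ex kxi u01.
by rewrite (proj_del_selects ck si); case: tG => -[_ <-] _ _ _; exists i.
Qed.

Lemma proj_del_bounded : exists C, forall xi u, `|proj_del t xi u| <= C.
Proof.
exists (\sum_(k < ds_num t) \sum_i `|p i|) => xi u.
apply: le_trans (ler_norm_sum _ _ _) _; apply: ler_sum => k _.
rewrite normrZ -[leRHS]mul1r ler_pM//.
  by rewrite indicE; case: (_ \in _); rewrite ?normr1 ?normr0.
apply: le_trans (ler_norm_sum _ _ _) _; rewrite big_mkcond /=.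
by apply: ler_sum => i _; case: ifP.
Qed.

(** Joint measurability in the point and the uniform variable, by replacing the
    barycentric coordinates on each cell by their measurable extensions. *)
Lemma proj_del_measurable :
  measurable_fun setT (fun xu : 'cV[R]_d * R => proj_del t xu.1 xu.2).
Proof.
have /choice[l lP] : forall k, exists l : 'I_N -> 'cV[R]_d -> R,
    (forall i, measurable_fun setT (l i)) /\
    forall xi, conv_hull (vertices k) xi -> forall i, bary k xi i = l i xi.
  by move=> k; exact: (bary_measurable tG).
pose c k m xi := \sum_(j < N | (j < m)%N) l k j xi.
have mc k m : measurable_fun setT (c k m).
  rewrite /c; under eq_fun do rewrite big_mkcond /=.
  apply: measurable_sum => j; case: (j < m)%N; last exact: measurable_cst.
  exact: (lP k).1.
have cE k m xi : ds_cell k xi -> cum_bary k xi m = c k m xi.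
  move=> ck; apply: eq_bigr => j _; apply: (lP k).2.
  by case: tG => _ _ _ [_ _ _]; exact.
pose s k (i : 'I_N) (xu : 'cV[R]_d * R) := c k i xu.1 <= xu.2 < c k i.+1 xu.1.
have ms k i : measurable_fun setT (s k i).
  apply: measurable_and.
    by apply: measurable_fun_ler => //; exact: measurableT_comp (mc k i) measurable_fst.
  by apply: measurable_fun_ltr => //; exact: measurableT_comp (mc k i.+1) measurable_fst.
have -> : (fun xu : 'cV[R]_d * R => proj_del t xu.1 xu.2) =
    fun xu => \sum_(k < ds_num t) \1_(ds_cell k) xu.1 *:
      (\sum_(i < N) (s k i xu)%:R *: p i).
  apply/funext => -[xi u] /=; apply: eq_bigr => k _; rewrite indicE.
  have [/set_mem ck|] := boolP (xi \in ds_cell k); last by rewrite !scale0r.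
  rewrite !scale1r big_mkcond /=; apply: eq_bigr => i _.
  rewrite -[(_ <= u < _)]/(selects k xi i u) /selects !cE// /s /=.
  by case: ifP; rewrite ?scale1r ?scale0r.
apply: measurable_mx => r e.
under eq_fun do rewrite summxE.
apply: measurable_sum => k; under eq_fun do rewrite mxE.
apply: measurable_funM.
  apply: measurableT_comp (_ : measurable_fun setT (\1_(ds_cell k) : 'cV[R]_d -> R)) measurable_fst.
  by apply: measurable_indic; case: tG => _ _ _ [].
under eq_fun do rewrite summxE.
apply: measurable_sum => i; under eq_fun do rewrite mxE.
apply: measurable_funM => //.
have -> : (fun x => (s k i x)%:R) = \1_[set x | s k i x] :> ('cV[R]_d * R -> R).
  apply/funext => x; rewrite indicE; congr (_%:R); congr nat_of_bool.
  by apply/idP/idP; rewrite inE.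
apply: measurable_indic.
by have := ms k i measurableT [set true] I; rewrite setTI.
Qed.

End dual_projection.

Section dual_jensen.
Context {dT : measure_display} {T : measurableType dT} {R : realType}.
Variables (P : probability T R) (U : T -> R).
Hypotheses (mU : measurable_fun setT U)
  (uU : forall B : set R, measurable B -> P (U @^-1` B) = uniform_prob (@ltr01 R) B).

Lemma uniform_itv (a b : R) : 0 <= a -> a <= b -> b <= 1 ->
  expect P (fun w => ((a <= U w < b)%R)%:R) = b - a.
Proof.
move=> a0 ab b1.
have -> : (fun w => ((a <= U w < b)%R)%:R) = \1_(U @^-1` `[a, b[) :> (T -> R).
  apply/funext => w; rewrite indicE; congr (_%:R); congr nat_of_bool.
  by apply/idP/idP; rewrite inE /= in_itv.
have mI : measurable (U @^-1` `[a, b[).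
  by have := mU measurableT (measurable_itv `[a, b[); rewrite setTI.
rewrite /expect /Rintegral integral_indic// setIT.
transitivity (fine (uniform_prob (@ltr01 R) `[a, b[)); first by congr fine; exact: uU.
rewrite /uniform_prob integral_uniform_pdf.
rewrite (_ : `[a, b[ `&` `[0, 1] = `[a, b[)%classic; last first.
  apply/seteqP; split=> x /=; rewrite !in_itv /=; first by case.
  by move=> /andP[ax xb]; split; apply/andP; split => //; lra.
rewrite (eq_integral (fun=> 1%:E)); last first.
  move=> x; rewrite inE /= in_itv /= => /andP[ax xb].
  rewrite /uniform_pdf ifT ?subr0 ?invr1//; apply/andP; split; lra.
rewrite integral_cst//= mul1e lebesgue_measure_itv /= lte_fin.
by case: ltP => //= ba; lra.
Qed.

(** The end point [1] is left out because it selects no vertex. *)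
Lemma uniform_ae : {ae P, forall w, 0 <= U w < 1}.
Proof.
have mI : measurable (U @^-1` `[0, 1[).
  by have := mU measurableT (measurable_itv `[0, 1[); rewrite setTI.
have P1 : P (U @^-1` `[0, 1[) = 1%E.
  rewrite -[LHS]fineK; last exact: fin_num_measure.
  have := uniform_itv (lexx 0) ler01 (lexx 1); rewrite subr0 => e.
  congr (_%:E); rewrite -[RHS]e /expect /Rintegral.
  rewrite -[U @^-1` _]setIT -integral_indic//; congr fine.
  apply: eq_integral => w _; rewrite indicE; congr (_%:R%:E); congr nat_of_bool.
  by apply/idP/idP; rewrite inE /= in_itv.
exists (~` (U @^-1` `[0, 1[)); split => //; first exact: measurableC.
  by rewrite probability_setC// P1 subee.
Qed.

(** The vertex of index [i] is selected with probability [bary k xi i], so that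
    the projection has mean [xi]; this is Jensen's inequality for it. *)
Lemma le_expect_proj_del d (t : dual_scheme R d) (G : set 'cV[R]_d)
    (f : 'cV[R]_d -> R) (xi : 'cV[R]_d) :
  delaunay t G -> is_convex f -> conv_hull G xi ->
  f xi <= expect P (fun w => f (proj_del t xi (U w))).
Proof.
move=> tG cf Gxi; have [k ck kxi] := conv_hull_cell tG Gxi.
have [[_ b1 bx] b0] := baryP tG kxi.
have bs i : bounded_meas (fun w => (selects k xi i (U w))%:R : R).
  have -> : (fun w => (selects k xi i (U w))%:R : R) = \1_[set w | selects k xi i (U w)].
    apply/funext => w; rewrite indicE; congr (_%:R); congr nat_of_bool.
    by apply/idP/idP; rewrite inE.
  apply: bounded_meas_indic.
  have mb : measurable_fun setT (fun w => selects k xi i (U w)).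
    by apply: measurable_and; [exact: measurable_fun_ler | exact: measurable_fun_ltr].
  by have := mb measurableT [set true] I; rewrite setTI.
have es i : expect P (fun w => (selects k xi i (U w))%:R) = bary k xi i.
  rewrite uniform_itv.
  - by rewrite cum_baryS addrAC subrr add0r.
  - by rewrite -(cum_bary0 k xi); exact: (le_cum_bary tG kxi).
  - exact: (le_cum_bary tG kxi).
  - by rewrite -(cum_bary_size tG kxi); exact: (le_cum_bary tG kxi).
rewrite -{1}bx; apply: le_trans (convex_jensen _ cf b0 b1) _.
have bsf i : bounded_meas (fun w => (selects k xi i (U w))%:R * f (ds_point i)).
  by under eq_fun do rewrite mulrC; exact: bounded_measZ.
have -> : \sum_i bary k xi i * f (ds_point i) =
    expect P (fun w => \sum_i (selects k xi i (U w))%:R * f (ds_point i)).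
  rewrite expect_sum//; apply: eq_bigr => i _.
  by under [in RHS]eq_fun do rewrite mulrC; rewrite expectZ// es mulrC.
apply: ae_le_expect; first exact: bounded_meas_sum.
  apply: convex_bounded_meas => //; split.
    exact: (measurableT_comp (proj_del_measurable tG)
      (measurable_fun_pair (measurable_cst xi) mU)).
  by have [C HC] := proj_del_bounded t; exists C.
have := uniform_ae; apply: filterS => w u01.
have [i si] := selects_ex tG kxi u01.
rewrite (proj_del_selects tG ck si).
by rewrite (sum_selects tG kxi (fun i => f (ds_point i) : R^o) si).
Qed.

End dual_jensen.

(** * One step of each scheme *)

Section step_expectations.
Context {dT : measure_display} {T : measurableType dT} {R : realType}.
Variable P : probability T R.

Lemma mx_norm_mul m p q (A : 'M[R]_(m, p)) (B : 'M[R]_(p, q)) :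
  `|A *m B| <= p%:R * `|A| * `|B|.
Proof.
apply: mx_norm_le => [|i j]; first by rewrite !mulr_ge0.
rewrite mxE; apply: le_trans (ler_norm_sum _ _ _) _.
rewrite (_ : _ * `|B| = \sum_(k < p) `|A| * `|B|); last first.
  by rewrite sumr_const card_ord -mulrA mulr_natl.
by apply: ler_sum => k _; rewrite normrM ler_pM// mx_norm_entry.
Qed.

Lemma mx_norm_euler d q (x : 'cV[R]_d) (A : 'M[R]_(d, q)) (z : 'cV[R]_q) C B D :
  `|x| <= C -> `|A| <= B -> `|z| <= D -> `|x + A *m z| <= C + q%:R * B * D.
Proof.
move=> xC AB zD; have B0 : 0 <= B by apply: le_trans AB.
apply: le_trans (ler_normD _ _) (lerD xC _).
apply: le_trans (mx_norm_mul _ _) _.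
by apply: ler_pM => //; apply: ler_wpM2l.
Qed.

Lemma measurable_euler {dS} {S : measurableType dS} d q
    (th : 'cV[R]_d -> 'M[R]_(d, q)) (X : S -> 'cV[R]_d) (Z : S -> 'cV[R]_q) :
  measurable_fun setT th -> measurable_fun setT X -> measurable_fun setT Z ->
  measurable_fun setT (fun w => X w + th (X w) *m Z w).
Proof.
move=> mth mX mZ; apply: measurable_mx => i j; under eq_fun do rewrite mxE.
apply: measurable_funD; first by move/measurable_mxP: mX; exact.
under eq_fun do rewrite mxE.
apply: measurable_sum => k; apply: measurable_funM.
  have /measurable_mxP : measurable_fun setT (fun w => th (X w)) by exact: measurableT_comp.
  exact.
by move/measurable_mxP: mZ; exact.
Qed.

Lemma measurable_col {dS} {S : measurableType dS} d n (l : 'I_n) (M : S -> 'M[R]_(d, n)) :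
  measurable_fun setT M -> measurable_fun setT (fun w => col l (M w)).
Proof.
move=> /measurable_mxP mM; apply: measurable_mx => i j.
by under eq_fun do rewrite mxE; exact: mM.
Qed.

Lemma measurable_set_col {dS} {S : measurableType dS} d n (l : 'I_n)
    (M : S -> 'M[R]_(d, n)) (X : S -> 'cV[R]_d) :
  measurable_fun setT M -> measurable_fun setT X ->
  measurable_fun setT (fun w => set_col l (M w) (X w)).
Proof.
move=> /measurable_mxP mM /measurable_mxP mX; apply: measurable_mx => i j.
by under eq_fun do rewrite mxE; case: (j == l); [exact: mX | exact: mM].
Qed.

Lemma mx_norm_set_col d n (l : 'I_n) (M : 'M[R]_(d, n)) (v : 'cV[R]_d) C :
  `|M| <= C -> `|v| <= C -> `|set_col l M v| <= C.
Proof.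
move=> MC vC; apply: mx_norm_le => [|i j]; first exact: le_trans MC.
by rewrite mxE; case: (j == l); [apply: le_trans vC | apply: le_trans MC];
  exact: mx_norm_entry.
Qed.

Lemma mx_norm_col d n (l : 'I_n) (M : 'M[R]_(d, n)) : `|col l M| <= `|M|.
Proof. by apply: mx_norm_le => // i j; rewrite mxE; exact: mx_norm_entry. Qed.

Lemma expect_euler_step d q n (k l : 'I_n) (th : 'cV[R]_d -> 'M[R]_(d, q))
    (M : T -> 'M[R]_(d, n)) (Z : T -> 'cV[R]_q) (f : 'M[R]_(d, n) -> R) :
  measurable_fun setT th ->
  (forall r, exists C, forall x, `|x| <= r -> `|th x| <= C) ->
  bounded_vec M -> bounded_vec Z -> indep_rv P M Z -> is_convex f ->
  expect P (fun w => f (set_col l (M w) (col k (M w) + th (col k (M w)) *m Z w))) =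
  expect P (fun w => euler_value P k l th Z f (M w)).
Proof.
move=> mth bth [mM [C MC]] [mZ [D ZD]] MZ cf.
have [B thB] := bth C.
pose h (mz : 'M[R]_(d, n) * 'cV[R]_q) : R :=
  f (set_col l mz.1 (col k mz.1 + th (col k mz.1) *m mz.2)).
have mh : measurable_fun setT h.
  apply: measurableT_comp (convex_measurable cf) _.
  apply: measurable_set_col; first exact: measurable_fst.
  apply: (measurable_euler mth); last exact: measurable_snd.
  by apply: measurable_col; exact: measurable_fst.
have [K fK] := convex_locally_bounded cf (C + q%:R * B * D).
have hK w w' : `|h (M w, Z w')| <= K.
  have colC : `|col k (M w)| <= C by apply: le_trans (mx_norm_col _ _) (MC w).
  have B0 : 0 <= B by apply: le_trans (thB _ colC).
  have D0 : 0 <= D by apply: le_trans (ZD w).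
  apply: fK; apply: mx_norm_set_col.
    by apply: le_trans (MC w) _; rewrite lerDl !mulr_ge0.
  by apply: mx_norm_euler; [| exact: thB | exact: ZD].
by have [_] := expect_freeze mM mZ MZ mh hK.
Qed.

Lemma le_expect_proj_step d n (l : 'I_n) (t : dual_scheme R d) (G : set 'cV[R]_d)
    (M : T -> 'M[R]_(d, n)) (U : T -> R) (f : 'M[R]_(d, n) -> R) :
  delaunay t G -> measurable_fun setT U ->
  (forall B : set R, measurable B -> P (U @^-1` B) = uniform_prob (@ltr01 R) B) ->
  bounded_vec M -> indep_rv P M U -> is_convex f ->
  {ae P, forall w, conv_hull G (col l (M w))} ->
  expect P (fun w => f (M w)) <=
  expect P (fun w => f (set_col l (M w) (proj_del t (col l (M w)) (U w)))).
Proof.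
move=> tG mU uU bM MU cf MG; have [mM [C MC]] := bM.
have [D pD] := proj_del_bounded t.
pose h (mu : 'M[R]_(d, n) * R) : R :=
  f (set_col l mu.1 (proj_del t (col l mu.1) mu.2)).
have mh : measurable_fun setT h.
  apply: measurableT_comp (convex_measurable cf) _.
  apply: measurable_set_col; first exact: measurable_fst.
  have m1 : measurable_fun setT (fun mu : 'M[R]_(d, n) * R => col l mu.1).
    by apply: measurable_col; exact: measurable_fst.
  exact: (measurableT_comp (proj_del_measurable tG)
    (measurable_fun_pair m1 measurable_snd)).
have [K fK] := convex_locally_bounded cf (Num.max C D).
have hK w w' : `|h (M w, U w')| <= K.
  apply: fK; apply: mx_norm_set_col; rewrite le_max; first by rewrite MC.
  by rewrite pD orbT.
have [bE ->] := expect_freeze mM mU MU mh hK.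
apply: ae_le_expect => //; first exact: convex_bounded_meas.
apply: filterS MG => w Gw.
have := le_expect_proj_del mU uU tG (is_convex_set_col l (M w) cf) Gw.
by rewrite set_col_col.
Qed.

End step_expectations.

Lemma transport_of_conditions {dT : measure_display} {T : measurableType dT}
    {R : realType} (P : probability T R) d q (Z : T -> 'cV[R]_q)
    (th : 'cV[R]_d -> 'M[R]_(d, q)) : q = d -> bounded_vec Z ->
  [\/ vanishing_cond_exp P Z /\ diag_nonneg_convex th,
      symmetric_cond_laws P Z /\ diag_abs_convex th |
      radial P Z /\ mx_convex th] ->
  convex_transport P Z th.
Proof.
move=> qd bZ; subst q; case=> -[hZ hth].
- exact: vanishing_transport.
- exact: symmetric_transport.
- exact: radial_transport.
Qed.

Section stopped_path.
Context {R : realType} {T : Type} {d : nat}.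
Variable n : nat.
Implicit Types X : nat -> T -> 'cV[R]_d.

(** The part of a path known at time [k], in the space of full paths, so that the
    induction on time compares random elements of a single space. *)
Definition stopped_path (k : nat) X (w : T) : 'M[R]_(d, n.+1) :=
  \matrix_(i, j) (if (j <= k)%N then X j w i 0 else 0).

Lemma stopped_pathn X : stopped_path n X = path_vec n X.
Proof.
by apply/funext => w; apply/matrixP => i j; rewrite !mxE -ltnS ltn_ord.
Qed.

Lemma col_stopped_path k X w : (k <= n)%N ->
  col (inord k) (stopped_path k X w) = X k w.
Proof.
by move=> kn; apply/colP => i; rewrite !mxE inordK ?ltnS// leqnn.
Qed.

Lemma stopped_pathS k X w : (k < n)%N ->
  stopped_path k.+1 X w = set_col (inord k.+1) (stopped_path k X w) (X k.+1 w).
Proof.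
move=> kn; apply/matrixP => i j; rewrite !mxE.
have -> : (j == inord k.+1) = (j == k.+1 :> nat) by rewrite -val_eqE /= inordK.
rewrite leq_eqVlt ltnS; case: eqP => [->|] //=.
Qed.

End stopped_path.

(** * The comparison of the two schemes *)

Section measurability_of_sigma.
Context {dT : measure_display} {T : measurableType dT}.

Lemma sigma_ofT {dE} {E : measurableType dE} (X : T -> E) : sigma_of X setT.
Proof. by exists setT => //; rewrite preimage_setT setTI. Qed.

Lemma sigma_ofI {dE} {E : measurableType dE} (X : T -> E) A B :
  sigma_of X A -> sigma_of X B -> sigma_of X (A `&` B).
Proof.
move=> [A' mA <-] [B' mB <-]; exists (A' `&` B'); first exact: measurableI.
by rewrite !setTI preimage_setI.
Qed.

Lemma sigma_of_measurable {dE} {E : measurableType dE} (X : T -> E) :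
  measurable_fun setT X -> sigma_of X `<=` measurable.
Proof. by move=> mX _ [B mB <-]; exact: mX. Qed.

End measurability_of_sigma.

Lemma finite_set_bounded {R : realType} {V : normedModType R} (A : set V) :
  finite_set A -> exists C, forall x, A x -> `|x| <= C.
Proof.
move=> /finite_seqP[s ->]; exists (\sum_(x <- s) `|x|) => x /= xs.
by rewrite (big_rem x)//= lerDl sumr_ge0.
Qed.

(** [a] counts the noises and [b] the uniform variables already used; two counters
    are needed since within a step the noise comes before the projection. *)
Definition known n (a b : nat) : pred ('I_1 + ('I_n + 'I_n)) :=
  fun s => match s with
  | inl _ => true | inr (inl i) => (i < a)%N | inr (inr i) => (i < b)%N end.

(* Families indexed by 1..n or 0..n-1 are families over nat, constrained on
   that range only. *)
Theorem theorem3p2 (R : realType) (dT : measure_display)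
    (T : measurableType dT) (P : probability T R)
    (d q n : nat) (d_gt0 : (0 < d)%N) (q_gt0 : (0 < q)%N) (n_gt0 : (0 < n)%N)
    (X0 : {RV P >-> 'cV[R]_d}) (Z : nat -> {RV P >-> 'cV[R]_q})
    (Z_indep : indep_family P (fun k : 'I_n => sigma_of (Z k.+1)))
    (Z_X0_indep : indep P (sigma_of X0)
      <<s \bigcup_(k in [set: 'I_n]) sigma_of (Z k.+1) >>)
    (Z_L2 : forall k, (1 <= k <= n)%N -> square_integrable P (Z k))
    (Z_centered : forall k, (1 <= k <= n)%N -> centered P (Z k))
    (phi : nat -> 'cV[R]_q -> 'cV[R]_q)
    (phi_borel : forall k, (1 <= k <= n)%N -> measurable_fun setT (phi k))
    (phi_bounded : forall k, (1 <= k <= n)%N ->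
      [bounded phi k z | z in [set: 'cV[R]_q]])
    (bZ := fun k : nat => phi k \o Z k)
    (bZ_centered : forall k, (1 <= k <= n)%N -> centered P (bZ k))
    (bZ_orth : forall k, (1 <= k <= n)%N -> forall i j : 'I_q,
      ('E_P[fun w => ((Z k w i 0 - bZ k w i 0) * bZ k w j 0)%R] = 0)%E)
    (U : nat -> {RV P >-> R})
    (U_uniform : forall k, (1 <= k <= n)%N -> forall B : set R, measurable B ->
      distribution P (U k) B = uniform_prob (@ltr01 R) B)
    (U_indep : indep_family P (fun k : 'I_n => sigma_of (U k.+1)))
    (U_X0_Z_indep : indep P
      <<s \bigcup_(k in [set: 'I_n]) sigma_of (U k.+1) >>
      <<s sigma_of X0 `|` \bigcup_(k in [set: 'I_n]) sigma_of (Z k.+1) >>)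
    (th : nat -> 'cV[R]_d -> 'M[R]_(d, q))
    (th_borel : forall k, (k < n)%N -> measurable_fun setT (th k))
    (th_locbounded : forall k, (k < n)%N ->
      [locally [bounded th k x | x in [set: 'cV[R]_d]]])
    (g0 : 'cV[R]_d -> 'cV[R]_d) (g0_borel : measurable_fun setT g0)
    (g0_finite : finite_set (range g0))
    (G : nat -> set 'cV[R]_d) (G0 : G 0%N = range g0)
    (G_finite : forall k, (1 <= k <= n)%N -> finite_set (G k))
    (G_hull : forall k, (1 <= k <= n)%N -> forall x, G k.-1 x -> forall w : T,
      conv_hull (G k) (x + th k.-1 x *m bZ k w))
    (t : nat -> dual_scheme R d)
    (t_delaunay : forall k, (1 <= k <= n)%N -> delaunay (t k) (G k))
    (bX := euler (g0 \o X0) th bZ)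
    (hX := quant_euler (g0 \o X0) th bZ t (fun k => U k : T -> R))
    (AorB :
      (* (A) *)
      ((forall k, (k < n)%N -> mx_convex (th k) /\ linear_growth (th k)) /\
       (forall k, (1 <= k <= n)%N -> radial P (bZ k)))
      \/
      (* (B) *)
      (q = d /\
       forall k, (k < n)%N ->
         [\/ vanishing_cond_exp P (bZ k.+1) /\ diag_nonneg_convex (th k),
             symmetric_cond_laws P (bZ k.+1) /\ diag_abs_convex (th k) |
             radial P (bZ k.+1) /\ mx_convex (th k)]))
    (cvx0 : cvx_le P (bX 0%N) (hX 0%N)) :
  cvx_le P (path_vec n bX) (path_vec n hX).
Proof.
have thB k : (k < n)%N -> forall r, exists C, forall x, `|x| <= r -> `|th k x| <= C.
  by move=> kn; exact: locally_bounded_ball (th_locbounded _ kn).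
have mbZ k : (1 <= k <= n)%N -> measurable_fun setT (bZ k).
  by move=> kn; exact: measurableT_comp (phi_borel _ kn) (measurable_funPT (Z k)).
have bbZ k : (1 <= k <= n)%N -> bounded_vec (bZ k).
  move=> kn; split; first exact: mbZ.
  have [M [_ HM]] := phi_bounded _ kn; exists (M + 1) => w.
  by apply: HM => //; rewrite ltrDl.
have tr k : (k < n)%N -> convex_transport P (bZ k.+1) (th k).
  move=> kn; have bZk := bbZ k.+1 kn.
  case: AorB => [[hA rA]|[qd hB]].
    by apply: radial_transport => //; [exact: rA | case: (hA k kn)].
  by apply: transport_of_conditions => //; exact: hB.
pose F := sources (sigma_of X0) (fun i : 'I_n => sigma_of (Z i.+1))
  (fun i : 'I_n => sigma_of (U i.+1)).
have FT i : F i setT by case: i => [i|[i|i]]; exact: sigma_ofT.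
have FI i A B : F i A -> F i B -> F i (A `&` B).
  by case: i => [i|[i|i]]; exact: sigma_ofI.
have Fm i : F i `<=` measurable.
  by case: i => [i|[i|i]]; apply: sigma_of_measurable; exact: measurable_funPT.
have indF A : (forall i, F i (A i)) -> P (\bigcap_i A i) = (\prod_i P (A i))%E.
  exact: (indep_sources Z_indep U_indep Z_X0_indep U_X0_Z_indep).
have kn1 k : (k < n)%N -> (1 <= k.+1 <= n)%N by [].
have ZF k (kn : (k < n)%N) : sigma_of (bZ k.+1) `<=` F (inr (inl (Ordinal kn))).
  move=> _ [B mB <-]; exists (phi k.+1 @^-1` B) => //.
  by have := phi_borel _ (kn1 _ kn) measurableT _ mB; rewrite setTI.
have pZ k a b : (k < n)%N -> (k < a)%N -> past_measurable F (known a b) (bZ k.+1).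
  by move=> kn ka; exact: (past_measurable_coord FT (j := inr (inl (Ordinal kn)))).
have pU k a b : (k < n)%N -> (k < b)%N -> past_measurable F (known a b) (U k.+1).
  by move=> kn kb; exact: (past_measurable_coord FT (j := inr (inr (Ordinal kn)))).
have iZ k dE (E : measurableType dE) (V : T -> E) : (k < n)%N ->
    past_measurable F (known k k) V -> indep_rv P V (bZ k.+1).
  move=> kn mV.
  by apply: (past_indep_rv FT FI Fm indF (j := inr (inl (Ordinal kn))) _ mV);
    [rewrite /= ltnn | exact: ZF].
have iU k dE (E : measurableType dE) (V : T -> E) : (k < n)%N ->
    past_measurable F (known k.+1 k) V -> indep_rv P V (U k.+1).
  move=> kn mV.
  by apply: (past_indep_rv FT FI Fm indF (j := inr (inr (Ordinal kn))) _ mV);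
    [rewrite /= ltnn |].
have knownS a b a' b' dE (E : measurableType dE) (V : T -> E) :
    (a <= a')%N -> (b <= b')%N ->
    past_measurable F (known a b) V -> past_measurable F (known a' b') V.
  move=> aa bb; apply: past_measurableS => -[//|[i|i]] /= h.
    exact: leq_trans h aa.
  exact: leq_trans h bb.
pose tX k w := hX k w + th k (hX k w) *m bZ k.+1 w.
have mtX k : (k < n)%N -> past_measurable F (known k k) (hX k) ->
    past_measurable F (known k.+1 k) (tX k).
  move=> kn mh; apply: (measurable_euler (th_borel _ kn)).
    by apply: knownS mh.
  exact: pZ.
have mX k : (k <= n)%N -> past_measurable F (known k k) (bX k) /\
    past_measurable F (known k k) (hX k).
  elim: k => [_|k IH kn].
    have m0 : past_measurable F (known 0 0) (g0 \o X0).
      apply: (measurableT_comp g0_borel).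
      exact: (past_measurable_coord FT (j := inl ord0)).
    by split.
  have [mb mh] := IH (ltnW kn); split.
    apply: (measurable_euler (th_borel _ kn)); last exact: pZ.
    by apply: knownS mb.
  have m1 : past_measurable F (known k.+1 k.+1) (tX k) by apply: knownS (mtX _ kn mh).
  exact: (measurableT_comp (proj_del_measurable (t_delaunay _ (kn1 _ kn)))
    (measurable_fun_pair m1 (pU _ k.+1 k.+1 kn (leqnn _)))).
have bXC k : (k <= n)%N -> (exists C, forall w, `|bX k w| <= C) /\
    (exists C, forall w, `|hX k w| <= C).
  elim: k => [_|k IH kn].
    have [C HC] := finite_set_bounded g0_finite.
    by split; exists C => w; apply: HC; exists (X0 w).
  have [[C bC] _] := IH (ltnW kn); split.
    have [B HB] := thB _ kn C; have [_ [D HD]] := bbZ _ (kn1 _ kn).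
    by exists (C + q%:R * B * D) => w; apply: mx_norm_euler; rewrite ?HB ?HD.
  have [D HD] := proj_del_bounded (t k.+1); exists D => w; exact: HD.
have bv k : (k <= n)%N -> bounded_vec (bX k) /\ bounded_vec (hX k).
  move=> kn; have [mb mh] := mX _ kn; have [bb bh] := bXC _ kn.
  by split; split => //; [exact: (past_measurable_fun Fm mb) | exact: (past_measurable_fun Fm mh)].
have bvS k (V : nat -> T -> 'cV[R]_d) : (forall j, (j <= k)%N -> bounded_vec (V j)) ->
    bounded_vec (stopped_path n k V).
  move=> bV; apply/bounded_vecP => i j; under eq_fun do rewrite mxE.
  case: leqP => jk; last exact: bounded_meas_cst.
  by have /bounded_vecP := bV _ jk; exact.
have mS k (V : nat -> T -> 'cV[R]_d) :
    (forall j, (j <= k)%N -> past_measurable F (known j j) (V j)) ->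
    past_measurable F (known k k) (stopped_path n k V).
  move=> mV; apply: measurable_mx => i j; under eq_fun do rewrite mxE.
  case: leqP => jk; last exact: measurable_cst.
  by have /measurable_mxP := knownS _ _ _ _ _ _ _ jk jk (mV _ jk); exact.
(* only almost surely: at [U = 1] the projection is [0] *)
have Gh k : (k <= n)%N -> {ae P, forall w, G k (hX k w)}.
  elim: k => [_|k IH kn].
    by apply: aeW => w; rewrite G0; exists (X0 w).
  have uk := uniform_ae (measurable_funPT (U k.+1)) (U_uniform _ (kn1 _ kn)).
  apply: filterS2 uk (IH (ltnW kn)) => w uw Gw.
  apply: (proj_del_grid (t_delaunay _ (kn1 _ kn))) => //.
  exact: (G_hull _ (kn1 _ kn)).
(* the induction goes forward in time, for all convex functions at once: a step
   of the Euler scheme replaces [f] by another convex function *)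
have main k : (k <= n)%N -> forall f : 'M[R]_(d, n.+1) -> R, is_convex f ->
    expect P (fun w => f (stopped_path n k bX w)) <=
    expect P (fun w => f (stopped_path n k hX w)).
  elim: k => [_|k IH kn] f cf.
    have -> : stopped_path n 0 bX = stopped_path n 0 hX; last exact: lexx.
    apply/funext => w; apply/matrixP => i j; rewrite !mxE.
    by case: leqP => //; rewrite leqn0 => /eqP ->.
  have kn' := ltnW kn.
  have bvb : bounded_vec (stopped_path n k bX).
    by apply: bvS => j jk; have [] := bv _ (leq_trans jk kn').
  have bvh : bounded_vec (stopped_path n k hX).
    by apply: bvS => j jk; have [] := bv _ (leq_trans jk kn').
  have mb : past_measurable F (known k k) (stopped_path n k bX).
    by apply: mS => j jk; have [] := mX _ (leq_trans jk kn').
  have mh : past_measurable F (known k k) (stopped_path n k hX).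
    by apply: mS => j jk; have [] := mX _ (leq_trans jk kn').
  have mtk := mtX _ kn (mX _ kn').2.
  pose l : 'I_n.+1 := inord k.+1; pose k' : 'I_n.+1 := inord k.
  have bZk := bbZ _ (kn1 _ kn).
  have -> : (fun w => f (stopped_path n k.+1 bX w)) = (fun w => f (set_col l
      (stopped_path n k bX w) (col k' (stopped_path n k bX w) +
        th k (col k' (stopped_path n k bX w)) *m bZ k.+1 w))).
    by apply/funext => w; rewrite stopped_pathS// !col_stopped_path.
  rewrite (expect_euler_step _ _ (th_borel _ kn) (thB _ kn) bvb bZk (iZ _ _ _ _ kn mb) cf).
  (* both schemes have the same value function, and it is convex *)
  apply: le_trans (IH kn' _ (euler_value_convex k' l bZk (tr _ kn) cf)) _.
  rewrite -(expect_euler_step _ _ (th_borel _ kn) (thB _ kn) bvh bZk (iZ _ _ _ _ kn mh) cf).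
  pose M w := set_col l (stopped_path n k hX w) (tX k w).
  have bM : bounded_vec M.
    apply: bounded_set_col => //; split; first exact: (past_measurable_fun Fm mtk).
    have [_ [C bC]] := (bXC _ kn').
    have [B HB] := thB _ kn C; have [_ [D HD]] := bZk.
    by exists (C + q%:R * B * D) => w; apply: mx_norm_euler; rewrite ?HB ?HD.
  have mM : past_measurable F (known k.+1 k) M.
    by apply: measurable_set_col => //; apply: knownS mh.
  have -> : (fun w => f (set_col l (stopped_path n k hX w)
      (col k' (stopped_path n k hX w) +
        th k (col k' (stopped_path n k hX w)) *m bZ k.+1 w))) = (fun w => f (M w)).
    by apply/funext => w; rewrite !col_stopped_path.
  have MG : {ae P, forall w, conv_hull (G k.+1) (col l (M w))}.
    apply: filterS (Gh _ kn') => w Gw; rewrite col_set_col.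
    exact: (G_hull _ (kn1 _ kn)).
  apply: le_trans (le_expect_proj_step (t_delaunay _ (kn1 _ kn))
    (measurable_funPT (U k.+1)) (U_uniform _ (kn1 _ kn)) bM (iU _ _ _ _ kn mM) cf MG) _.
  rewrite le_eqVlt; apply/orP; left; apply/eqP; congr expect; apply/funext => w.
  by rewrite /M col_set_col set_col_set_col stopped_pathS.
have [bvb bvh] : bounded_vec (stopped_path n n bX) /\ bounded_vec (stopped_path n n hX).
  by split; apply: bvS => j /bv[].
have iv X : bounded_vec (stopped_path n n X) -> integrable_vec P (path_vec n X).
  rewrite stopped_pathn => bV; split; first by case: bV.
  by move=> i j; apply: bounded_meas_integrable; move/bounded_vecP: bV; exact.
split; [exact: iv | exact: iv|] => f /convex_functionP cf.
rewrite -!stopped_pathn !expectationE; try exact: convex_bounded_meas.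
by rewrite lee_fin; exact: main.
Qed.
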